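(* Let $\mathbb{K}$ be an algebraically closed field of characteristic zero and let $G$ be a connected commutative linear algebraic group over $\mathbb{K}$ of dimension $n\ge 1$ and rank $r\ge 1$. Then there exist, up to equivalence, precisely $p_r(n)$ prehomogeneous $G$-modules $V$ such that the group $G\subseteq\mathrm{GL}(V)$ is normalized by the group of all invertible diagonal matrices on $V$ (with respect to some basis of $V$). The corresponding algebras $A$ are precisely the algebras (of dimension $n$ with $r$ local summands) such that $a^2=0$ for every nilpotent $a\in A$.
   Context: For positive integers $n$ and $r$, $p_r(n)$ denotes the number of partitions $n=n_1+\ldots+n_r$ with integers $n_1\ge\ldots\ge n_r\ge 1$. Every connected commutative linear algebraic group over $\mathbb{K}$ is isomorphic to $(\mathbb{G}_m)^r\times(\mathbb{G}_a)^s$ for unique $r,s\ge 0$; $r$ is its rank. A prehomogeneous $G$-module is a finite dimensional $\mathbb{K}$-vector space $V$ with an effective linear algebraic action of $G$, so that $G$ is identified with a closed subgroup of $\mathrm{GL}(V)$, such that $G$ has an open orbit in $V$. Two prehomogeneous modules $V,V'$ are equivalent if there is an isomorphism of vector spaces $V\to V'$ whose induced isomorphism $\mathrm{GL}(V)\to\mathrm{GL}(V')$ maps the image of the group acting on $V$ onto the image of the group acting on $V'$. For a finite dimensional commutative associative unital $\mathbb{K}$-algebra $A$, its group $G(A)$ of invertible elements acts on $A$ by multiplication, making $A$ a prehomogeneous $G(A)$-module. Every prehomogeneous $G$-module $V$ of a commutative linear algebraic group is equivalent to the $G(A)$-module $A$ for such an algebra $A$, unique up to isomorphism; $A$ is called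 the algebra corresponding to $V$. Every such $A$ decomposes uniquely as a direct sum of local algebras, called its local summands. *)

(* Defs.v *)
From mathcomp Require Import all_boot all_order all_algebra all_field.
From mathcomp Require Import mpoly.

Set Implicit Arguments.
Unset Strict Implicit.
Unset Printing Implicit Defensive.

Import GRing.Theory.
Local Open Scope ring_scope.

(* [p_r(n)]: partitions [n = n_1 + ... + n_r] with [n_1 >= ... >= n_r >= 1].
   Each part is at most [n], whence the bounded parts ['I_n.+1]. *)
Definition num_partitions (r n : nat) : nat :=
  #|[set t : r.-tuple 'I_n.+1 |
      [&& sorted geq (map val t), all (leq 1) (map val t)
        & sumn (map val t) == n]]|.

Section LinearAlgebraicGroups.
Variable K : fieldType.

(* Subsets of [GL_N(K)] are predicates on ['M[K]_N] contained in [unitmx];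
   polynomials in the matrix entries are indexed through [mxvec]. *)
Definition mx_eval N (p : {mpoly K[N * N]}) (A : 'M[K]_N) : K :=
  p.@[fun i => mxvec A ord0 i].

Definition GL_closed N (X : 'M[K]_N -> Prop) : Prop :=
  exists S : {mpoly K[N * N]} -> Prop,
    forall A, X A <-> A \in unitmx /\ forall p, S p -> mx_eval p A = 0.

Definition lin_alg_group N (G : 'M[K]_N -> Prop) : Prop :=
  [/\ GL_closed G, G 1%:M,
      forall A B, G A -> G B -> G (A *m B)
    & forall A, G A -> G (invmx A)].

Definition zariski_connected N (X : 'M[K]_N -> Prop) : Prop :=
  forall Y Z : 'M[K]_N -> Prop, GL_closed Y -> GL_closed Z ->
    (forall A, X A <-> Y A \/ Z A) -> (forall A, Y A -> ~ Z A) ->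
    ~ ((exists A, Y A) /\ (exists A, Z A)).

Definition mx_commutative N (G : 'M[K]_N -> Prop) : Prop :=
  forall A B, G A -> G B -> A *m B = B *m A.

(* Regular functions on a closed subset of the affine variety [GL_N]:
   restrictions of elements of [K[x_ij, 1/det]]. *)
Definition regular_on N (X : 'M[K]_N -> Prop) (f : 'M[K]_N -> K) : Prop :=
  exists (p : {mpoly K[N * N]}) (k : nat),
    forall A, X A -> f A = mx_eval p A / \det A ^+ k.

Definition alg_independent_on N (X : 'M[K]_N -> Prop) d
    (f : 'I_d -> 'M[K]_N -> K) : Prop :=
  forall P : {mpoly K[d]}, (forall A, X A -> P.@[fun i => f i A] = 0) -> P = 0.

(* The dimension of an affine variety is the maximal number of algebraically
   independent regular functions on it; when it is irreducible, this is the
   transcendence degree of its function field. *)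
Definition has_dimension N (X : 'M[K]_N -> Prop) (n : nat) : Prop :=
  let indep d := exists f : 'I_d -> 'M[K]_N -> K,
    (forall i, regular_on X (f i)) /\ alg_independent_on X f in
  indep n /\ forall d, indep d -> (d <= n)%N.

Definition group_morphism N M (G : 'M[K]_N -> Prop) (H : 'M[K]_M -> Prop)
    (phi : 'M[K]_N -> 'M[K]_M) : Prop :=
  [/\ forall A, G A -> H (phi A),
      forall A B, G A -> G B -> phi (A *m B) = phi A *m phi B
    & forall i j, regular_on G (fun A => phi A i j)].

Definition group_isomorphic N M
    (G : 'M[K]_N -> Prop) (H : 'M[K]_M -> Prop) : Prop :=
  exists (phi : 'M[K]_N -> 'M[K]_M) (psi : 'M[K]_M -> 'M[K]_N),
    [/\ group_morphism G H phi, group_morphism H G psi,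
        forall A, G A -> psi (phi A) = A
      & forall B, H B -> phi (psi B) = B].

(* [(G_m)^r x (G_a)^s] as a closed subgroup of [GL_(r + (1 + s))]: a torus
   element [t] sits in the diagonal block [diag t], and a vector [x] sits in
   the unipotent block [[1, x], [0, 1]]. *)
Definition torus_vector_group r s (A : 'M[K]_(r + (1 + s))) : Prop :=
  exists (t : 'rV[K]_r) (x : 'rV[K]_s),
    (forall i, t ord0 i != 0) /\
    A = block_mx (diag_mx t) 0 0 (block_mx 1%:M x 0 1%:M).

Definition has_rank N (G : 'M[K]_N -> Prop) (r : nat) : Prop :=
  exists s : nat, group_isomorphic G (@torus_vector_group r s).

End LinearAlgebraicGroups.

Section Modules.
Variable K : fieldType.

Definition vect_eval (V : vectType K) (p : {mpoly K[\dim {:V}]}) (v : V) : K :=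
  p.@[fun i => coord (vbasis {:V}) i v].

Definition zariski_open (V : vectType K) (U : V -> Prop) : Prop :=
  exists S : {mpoly K[\dim {:V}]} -> Prop,
    forall v, U v <-> ~ (forall p, S p -> vect_eval p v = 0).

(* Only the values of [act] on [G] matter. The action is effective and
   algebraic; the latter means that all matrix coefficients are regular. *)
Record prehom_module N (G : 'M[K]_N -> Prop) := PrehomModule {
  space :> vectType K;
  act : 'M[K]_N -> 'End(space);
  act1 : act 1%:M = \1%VF;
  actM : forall A B, G A -> G B -> act (A *m B) = (act A \o act B)%VF;
  act_regular : forall (l : 'Hom(space, K^o)) (v : space),
    regular_on G (fun A => l (act A v));
  act_effective : forall A, G A -> act A = \1%VF -> A = 1%:M;
  act_open_orbit : exists v : space,
    zariski_open (fun w : space => exists2 A, G A & w = act A v)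
}.

Definition image_group N (G : 'M[K]_N -> Prop) (V : prehom_module G)
    (h : 'End(V)) : Prop := exists2 A, G A & h = act V A.

(* [V] with the subgroup [H] of [GL(V)] is equivalent to [W] with [H']: the
   bijection [h |-> f h f^-1] from [GL(V)] to [GL(W)] maps [H] onto [H']. *)
Definition equivalent (V W : vectType K)
    (H : 'End(V) -> Prop) (H' : 'End(W) -> Prop) : Prop :=
  exists f : 'Hom(V, W),
    bijective f /\ forall h : 'End(V), H h <-> H' (f \o h \o f^-1)%VF.

Definition diagonal_wrt (V : vectType K) (b : seq V) (D : 'End(V)) : Prop :=
  forall v, v \in b -> exists2 c : K, c != 0 & D v = c *: v.

Definition normalizes (V : vectType K) (D : 'End(V)) (H : 'End(V) -> Prop) :=
  forall h : 'End(V), H h <-> H (D \o h \o D^-1)%VF.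

Definition normalized_by_diagonal (V : vectType K) (H : 'End(V) -> Prop) :=
  exists2 b : seq V, basis_of {:V} b &
    forall D, diagonal_wrt b D -> normalizes D H.

End Modules.

Arguments image_group {K N G} V h.

Section Algebras.
Variable K : fieldType.

(* Finite dimensional commutative associative unital algebras are taken as
   [A : falgType K] with a commutativity hypothesis; these are nonzero. *)
Definition alg_commutative (A : falgType K) : Prop :=
  forall a b : A, a * b = b * a.

(* The image of the group [G(A)] of invertible elements in [GL(A)]. *)
Definition unit_group (A : falgType K) (h : 'End(A)) : Prop :=
  exists2 u : A, u \is a GRing.unit & h = amull u.

(* Ideals of a [K]-algebra are linear subspaces. *)
Definition alg_ideal (A : falgType K) (I : {vspace A}) : Prop :=
  forall a x : A, x \in I -> a * x \in I.

Definition alg_maximal_ideal (A : falgType K) (M : {vspace A}) : Prop :=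
  [/\ alg_ideal M, M != {:A}%VS
    & forall J : {vspace A}, alg_ideal J -> (M <= J)%VS ->
        J = M \/ J = {:A}%VS].

Definition alg_local (A : falgType K) : Prop :=
  alg_commutative A /\ exists! M : {vspace A}, alg_maximal_ideal M.

(* [A] is the direct sum of [r] local algebras [B i], by means of projections
   [p i : A -> B i] that jointly identify [A] with the product of the [B i]. *)
Definition has_local_summands (A : falgType K) (r : nat) : Prop :=
  exists (B : 'I_r -> falgType K) (p : forall i, 'AHom(A, B i)),
    (forall i, alg_local (B i)) /\
    (forall y : forall i, B i, exists! a : A, forall i, p i a = y i).

Definition nilpotent_square_zero (A : falgType K) : Prop :=
  forall a : A, (exists k : nat, a ^+ k = 0) -> a ^+ 2 = 0.

End Algebras.

Arguments unit_group {K} A h.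

(* Main.v *)
(* Idea. Let [v0] lie in the open orbit. Evaluation at [v0] identifies the span of
   the commutative group [G] in [End V] with [V], which makes [V] a commutative
   algebra [A]; two nonempty open subsets of an affine space meet, so the open
   subgroup [G] of [A^x] is all of it.  If the diagonal matrices normalize [A^x],
   then [A] is stable under conjugation by a torus and contains [E_ij] as soon as
   some member of [A] has a nonzero off-diagonal [(i, j)] entry; commutativity then
   forces nilpotent elements to have square zero.  Such an algebra is [K^r + K^s]
   with [K^s] of square zero, each coordinate of [K^s] being fixed by exactly one of
   the [r] idempotents, so it amounts to a partition of [r + s] into [r] parts
   (one plus the number of coordinates attached to an idempotent).  The parts are
   the multiplicities in the characteristic polynomial of an element with [r]
   distinct eigenvalues.  The numbers [r] and [s] are read off from [G]: there are
   [2 ^ r] elements of order at most 2, and polynomial homomorphisms from [G_a] to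
   [A^x] are linear in characteristic zero, which bounds [s]. *)

From HB Require Import structures.
Require Import Defs.
From mathcomp Require Import all_boot all_order all_algebra all_field perm.
From mathcomp Require Import mpoly ring.
From Stdlib Require Import Classical.

Set Implicit Arguments.
Unset Strict Implicit.
Unset Printing Implicit Defensive.

Import GRing.Theory.
Local Open Scope ring_scope.

(** * Polynomial functions *)

(** Dimension is the delicate invariant, since [has_dimension] only counts algebraically independent
    regular functions. The equality [n = r + s] needs a bound from each side: pulled back along the
    isomorphism with the torus-vector group, regular functions are rational in [r + s] variables;
    conversely, a module built from a model of dimension [r + s] has that many independent
    coordinates along its open orbit. The same orbit argument bounds the dimension of every module
    by [n]; that a normalized module reaches [n] comes from a linear injection of the vector part of
    [G] into the nilpotent part of [A]. Topology never goes beyond lines: an open set is used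
    through one polynomial that is nonzero at a known point, restricted to a line, where its zeros
    are finite in number. Normalization by diagonal matrices speaks of units only; it reaches all of
    [A] because every element is a unit up to a scalar. *)

Section FunSubring.
Variables (K : fieldType) (T : Type).

(** Polynomial, regular and rational functions share these closure properties, so sums, determinants
    and polynomial expressions are treated once for all of them. The field [fs_ext] stands in for
    functional extensionality. *)
Record fun_subring (C : (T -> K) -> Prop) : Prop := FunSubring {
  fs_const : forall c, C (fun=> c);
  fs_add : forall f g, C f -> C g -> C (fun x => f x + g x);
  fs_mul : forall f g, C f -> C g -> C (fun x => f x * g x);
  fs_ext : forall f g, f =1 g -> C f -> C g }.

Variables (C : (T -> K) -> Prop) (hC : fun_subring C).

Lemma fs_sum I (s : seq I) (P : pred I) (f : I -> T -> K) :
  (forall i, C (f i)) -> C (fun x => \sum_(i <- s | P i) f i x).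
Proof.
move=> Cf; elim: s => [|i s IH].
  by apply: (fs_ext hC) (fs_const hC 0) => x; rewrite big_nil.
have [Pi|nPi] := boolP (P i).
  apply: (fs_ext hC) (fs_add hC (Cf i) IH) => x.
  by rewrite big_cons Pi.
by apply: (fs_ext hC) IH => x; rewrite big_cons (negPf nPi).
Qed.

Lemma fs_prod I (s : seq I) (P : pred I) (f : I -> T -> K) :
  (forall i, C (f i)) -> C (fun x => \prod_(i <- s | P i) f i x).
Proof.
move=> Cf; elim: s => [|i s IH].
  by apply: (fs_ext hC) (fs_const hC 1) => x; rewrite big_nil.
have [Pi|nPi] := boolP (P i).
  apply: (fs_ext hC) (fs_mul hC (Cf i) IH) => x.
  by rewrite big_cons Pi.
by apply: (fs_ext hC) IH => x; rewrite big_cons (negPf nPi).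
Qed.

Lemma fs_exp (f : T -> K) k : C f -> C (fun x => f x ^+ k).
Proof.
move=> Cf; elim: k => [|k IH].
  by apply: (fs_ext hC) (fs_const hC 1).
by apply: (fs_ext hC) (fs_mul hC Cf IH) => x; rewrite exprS.
Qed.

Lemma fs_meval d (p : {mpoly K[d]}) (f : 'I_d -> T -> K) :
  (forall i, C (f i)) -> C (fun x => p.@[fun i => f i x]).
Proof.
move=> Cf; apply: (fs_ext hC (f := fun x =>
  \sum_(m <- msupp p) p@_m * \prod_i f i x ^+ m i)).
  by move=> x; rewrite mevalE.
apply: fs_sum => m; apply: (fs_mul hC); first exact: fs_const.
by apply: fs_prod => i; apply: fs_exp.
Qed.

Lemma fs_det d (M : T -> 'M[K]_d) :
  (forall i j, C (fun x => M x i j)) -> C (fun x => \det (M x)).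
Proof.
move=> CM; rewrite /determinant; apply: fs_sum => s.
apply: (fs_mul hC); first exact: fs_const.
by apply: fs_prod => i.
Qed.

Lemma fs_mx_eval d (p : {mpoly K[d * d]}) (M : T -> 'M[K]_d) :
  (forall i j, C (fun x => M x i j)) -> C (fun x => mx_eval p (M x)).
Proof.
move=> CM; apply: fs_meval => l.
case/mxvec_indexP: l => i j.
by apply: (fs_ext hC) (CM i j) => x; rewrite mxvecE.
Qed.

End FunSubring.

Section PolynomialFunctions.
Variable K : fieldType.

Definition poly_fun (f : K -> K) := exists p : {poly K}, forall x, f x = p.[x].

Lemma poly_fun_subring : fun_subring poly_fun.
Proof.
split.
- by move=> c; exists c%:P => x; rewrite hornerC.
- by move=> f g [p pE] [q qE]; exists (p + q) => x; rewrite hornerD pE qE.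
- by move=> f g [p pE] [q qE]; exists (p * q) => x; rewrite hornerM pE qE.
- by move=> f g fg [p pE]; exists p => x; rewrite -fg.
Qed.

Lemma poly_fun_line (a b : K) : poly_fun (fun x => a + x * b).
Proof.
by exists (a%:P + 'X * b%:P) => x; rewrite !(hornerD, hornerM, hornerX, hornerC).
Qed.

Definition mpoly_fun d T (co : T -> 'I_d -> K) (f : T -> K) :=
  exists p : {mpoly K[d]}, forall x, f x = p.@[co x].

Lemma mpoly_fun_subring d T (co : T -> 'I_d -> K) :
  fun_subring (mpoly_fun co).
Proof.
split.
- by move=> c; exists c%:MP => x; rewrite mevalC.
- by move=> f g [p pE] [q qE]; exists (p + q) => x; rewrite mevalD pE qE.
- by move=> f g [p pE] [q qE]; exists (p * q) => x; rewrite mevalM pE qE.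
- by move=> f g fg [p pE]; exists p => x; rewrite -fg.
Qed.

Lemma mpoly_fun_coord d T (co : T -> 'I_d -> K) i :
  mpoly_fun co (fun x => co x i).
Proof. by exists 'X_i => x; rewrite mevalXU. Qed.

(** Denominators are powers of the determinant, itself a polynomial in the entries that does not
    vanish on [X], so sums have a common denominator. *)
Lemma regular_on_subring N (X : 'M[K]_N -> Prop) :
  (forall A, X A -> A \in unitmx) -> fun_subring (regular_on X).
Proof.
move=> Xu; have dN0 A k : X A -> \det A ^+ k != 0.
  by move/Xu; rewrite unitmxE unitfE => dA; rewrite expf_neq0.
have detE : exists q : {mpoly K[N * N]}, forall A, \det A = mx_eval q A.
  pose co (A : 'M[K]_N) (i : 'I_(N * N)) := mxvec A ord0 i.
  apply: (fs_det (mpoly_fun_subring co) (M := id)) => i j.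
  have [p pE] := mpoly_fun_coord co (mxvec_index i j).
  by exists p => A; rewrite -pE /co mxvecE.
have [q qE] := detE.
split.
- move=> c; exists c%:MP, 0 => A _.
  by rewrite /mx_eval mevalC expr0 divr1.
- move=> f g [p [k pE]] [p' [k' p'E]].
  exists (p * q ^+ k' + p' * q ^+ k), (k + k')%N => A XA.
  rewrite pE // p'E // /mx_eval mevalD !mevalM !rmorphXn /= exprD.
  have := qE A; rewrite /mx_eval => <-.
  by rewrite addf_div ?dN0.
- move=> f g [p [k pE]] [p' [k' p'E]].
  exists (p * p'), (k + k')%N => A XA.
  by rewrite pE // p'E // /mx_eval mevalM exprD mulf_div.
- by move=> f g fg [p [k pE]]; exists p, k => A XA; rewrite -fg pE.
Qed.

(** In characteristic zero the natural numbers are distinct points of [K], and [size p] of them are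
    one root more than a nonzero [p] allows. *)
Lemma poly_fun_infinite (hK : [pchar K] =i pred0) (p : {poly K}) :
  (forall n : nat, p.[n%:R] = 0) -> p = 0.
Proof.
have /pcharf0P natr0 := hK.
move=> p0; apply/eqP/negPn/negP => pn0.
pose s := [seq (i%:R : K) | i <- iota 0 (size p)].
have := max_poly_roots pn0 (rs := s).
rewrite size_map size_iota ltnn; move=> H; suff: false by [].
apply: H.
  by apply/allP => _ /mapP[i _ ->]; rewrite rootE p0.
rewrite map_inj_in_uniq ?iota_uniq // => i j _ _.
wlog ij : i j / (i <= j)%N.
  by move=> W; case/orP: (leq_total i j) => h e; [|apply/esym]; apply: W.
move=> /eqP; rewrite eq_sym -subr_eq0 -natrB // natr0 subn_eq0 => ji.
by apply/eqP; rewrite eqn_leq ij.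
Qed.

(** Uniqueness of base-[D] digits, which keeps monomials apart under the Kronecker substitution. *)
Lemma base_expansion_inj d D (m m' : 'I_d -> nat) :
  (forall i, m i < D)%N -> (forall i, m' i < D)%N ->
  (\sum_i m i * D ^ i = \sum_i m' i * D ^ i)%N -> m =1 m'.
Proof.
elim: d m m' => [|d IH] m m' mD m'D; first by move=> _ [].
have D0 : (0 < D)%N by apply: leq_ltn_trans (mD ord0).
have E (f : 'I_d.+1 -> nat) : (\sum_i f i * D ^ i =
    (\sum_(i < d) f (lift ord0 i) * D ^ i) * D + f ord0)%N.
  rewrite big_ord_recl expn0 muln1 addnC big_distrl /=; congr addn.
  by apply: eq_bigr => i _; rewrite /= /bump /= add1n expnSr mulnA.
rewrite !E => eqm.
have e0 : m ord0 = m' ord0.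
  have := congr1 (modn^~ D) eqm.
  by rewrite !modnMDl !modn_small.
move: eqm; rewrite e0 => /addIn /eqP; rewrite eqn_pmul2r // => /eqP eqm.
have {}IH := IH _ _ (fun i => mD _) (fun i => m'D _) eqm.
by move=> i; case: (unliftP ord0 i) => [j|] -> //; apply: IH.
Qed.

(* Kronecker substitution [x_i := x ^ (D ^ i)]. *)
Lemma mpoly_vanishing (hK : [pchar K] =i pred0) d (p : {mpoly K[d]}) :
  (forall v, p.@[v] = 0) -> p = 0.
Proof.
move=> p0; pose D := msize p.
pose e (m : 'X_{1..d}) := (\sum_i m i * D ^ i)%N.
have mD m : m \in msupp p -> forall i, (m i < D)%N.
  move=> mp i; apply: leq_ltn_trans (msize_mdeg_lt mp).
  by rewrite mdegE (bigD1 i) //= leq_addr.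
pose q : {poly K} := \sum_(m <- msupp p) p@_m *: 'X^(e m).
have q0 : q = 0.
  apply: poly_fun_infinite => // n.
  rewrite -(p0 (fun i => n%:R ^+ (D ^ i))) mevalE /q horner_sum.
  apply: eq_bigr => m _; rewrite hornerZ hornerXn; congr (_ * _).
  rewrite /e -prodrXr; apply: eq_bigr => i _.
  by rewrite -exprM mulnC.
apply/mpolyP => m; rewrite mcoeff0; apply/eqP/negPn/negP => pm.
have mp : m \in msupp p by rewrite mcoeff_msupp.
have := congr1 (fun q : {poly K} => q`_(e m)) q0.
rewrite coef0 /q coef_sum (bigD1_seq m) ?msupp_uniq //=.
rewrite coefZ coefXn eqxx mulr1 big_seq_cond big1 ?addr0; first exact/eqP.
move=> m' /andP[m'p nm]; rewrite coefZ coefXn; case: eqP => [E|_]; last first.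
  by rewrite mulr0.
case/eqP: nm; apply/mnmP => i; apply: (base_expansion_inj (D := D)) => //.
- exact: mD.
- exact: mD.
Qed.

End PolynomialFunctions.

(** * Algebraic dependence *)

Section AlgebraicDependence.
Variable K : fieldType.

Lemma msize_prod_le m (I : Type) (s : seq I) (R : I -> {mpoly K[m]}) D :
  (forall i, (msize (R i) <= D)%N) ->
  (msize (\prod_(i <- s) R i) <= (size s * D.+1).+1)%N.
Proof.
move=> RD; elim: s => [|i s IH]; first by rewrite big_nil msize1.
rewrite big_cons; apply: leq_trans (msizeM_le _ _) _.
rewrite /= mulSn addSn !ltnS; apply: leq_trans (leq_add (RD i) IH) _.
by rewrite addnS.
Qed.

Lemma msize_exp_le m (p : {mpoly K[m]}) D k :
  (msize p <= D)%N -> (msize (p ^+ k) <= (k * D.+1).+1)%N.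
Proof.
move=> pD; have := msize_prod_le (nseq k tt) (R := fun=> p) (fun=> pD).
rewrite size_nseq big_const_seq count_predT size_nseq.
by rewrite -Monoid.iteropE.
Qed.

Lemma nonzero_relation (I J : finType) (M : I -> J -> K) :
  (#|J| < #|I|)%N ->
  exists2 c : I -> K, exists i, c i != 0 & forall j, \sum_i c i * M i j = 0.
Proof.
move=> JI; pose A := \matrix_(i < #|I|, j < #|J|) M (enum_val i) (enum_val j).
have kA : kermx A != 0.
  rewrite -mxrank_eq0 mxrank_ker subn_eq0 -ltnNge.
  by apply: leq_ltn_trans JI; apply: rank_leq_col.
case/rowV0Pn: kA => v /sub_kermxP vA /rV0Pn[i vi].
exists (fun i => v 0 (enum_rank i)).
  by exists (enum_val i); rewrite enum_valK.
move=> j; have := congr1 (fun B : 'rV_#|J| => B 0 (enum_rank j)) vA.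
rewrite !mxE => E; rewrite -[RHS]E (reindex (@enum_val I I)) /=; last first.
  by exists enum_rank => x _; rewrite ?enum_valK ?enum_rankK.
by apply: eq_bigr => k _; rewrite enum_valK mxE enum_rankK.
Qed.

(** A size of at most [B] keeps every exponent below [B], so at most [B ^ m] coefficients matter. *)
Lemma msize_bounded_dependent (I : finType) m B (R : I -> {mpoly K[m]}) :
  (forall i, (msize (R i) <= B)%N) -> (B ^ m < #|I|)%N ->
  exists2 c : I -> K, exists i, c i != 0 & \sum_i c i *: R i = 0.
Proof.
move=> RB cI.
pose mon (f : {ffun 'I_m -> 'I_B}) : 'X_{1..m} := [multinom (f i : nat) | i < m].
have [|c c0 cR] := @nonzero_relation I {ffun 'I_m -> 'I_B}
  (fun i f => (R i)@_(mon f)).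
  by rewrite card_ffun !card_ord.
exists c => //; apply/mpolyP => k; rewrite mcoeff0 raddf_sum /=.
have [/forallP kB|] := boolP [forall i, (k i < B)%N].
  have -> : k = mon [ffun i => Ordinal (kB i)].
    by apply/mnmP => i; rewrite mnmE ffunE.
  rewrite -[RHS](cR [ffun i => Ordinal (kB i)]).
  by apply: eq_bigr => i _; rewrite mcoeffZ.
rewrite negb_forall => /existsP[j kj].
apply: big1 => i _; rewrite mcoeffZ memN_msupp_eq0 ?mulr0 //.
apply: contra kj => /msize_mdeg_lt /leq_trans/(_ (RB i)); apply: leq_ltn_trans.
by rewrite mdegE (bigD1 j) //= leq_addr.
Qed.

(* Counting: the [M ^ d] products of powers below [M] of the [P i / Q] live in a
   space of dimension [O(M ^ m)]. *)
Lemma rational_dependent d m (P : 'I_d -> {mpoly K[m]}) (Q : {mpoly K[m]}) :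
  (m < d)%N ->
  exists2 F : {mpoly K[d]}, F != 0 &
    forall v, Q.@[v] != 0 -> F.@[fun i => (P i).@[v] / Q.@[v]] = 0.
Proof.
move=> md.
pose D := maxn (msize Q) (\max_i msize (P i)).
(* Each of the [d] factors has size at most [M * D.+1 + 3]; [D + 5] absorbs the 3 and the cost of
   the multiplications, so [R e] has size at most [M * E]. The [M ^ d] polynomials [R e] then
   involve at most [M ^ m * E ^ m] monomials, which is less than [M ^ m.+1] since [M > E ^ m]. *)
pose E := (d * (D + 5)).+1; pose M := (E ^ m).+1.
pose R (e : {ffun 'I_d -> 'I_M}) := \prod_i (P i ^+ e i * Q ^+ (M - e i)).
have RB e : (msize (R e) <= M * E)%N.
  have T i : (msize (P i ^+ e i * Q ^+ (M - e i)) <= M * D.+1 + 3)%N.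
    apply: leq_trans (msizeM_le _ _) _.
    have PD : (msize (P i) <= D)%N.
      by rewrite leq_max (bigmax_sup i) ?orbT.
    have QD : (msize Q <= D)%N by rewrite leq_max leqnn.
    have := leq_add (msize_exp_le (e i) PD) (msize_exp_le (M - e i) QD).
    rewrite addSn addnS -mulnDl subnKC ?(ltnW (ltn_ord _)) // => H.
    by rewrite addn3 ltnS.
  apply: leq_trans (msize_prod_le _ T) _.
  rewrite [index_enum _]unlock -enumT size_enum_ord.
  have M0 : (0 < M)%N by [].
  have h : ((M * D.+1 + 3).+1 <= M * (D + 5))%N.
    by rewrite -addnS [(D + 5)%N]addnS -addSn mulnDr leq_add2l leq_pmull.
  have := leq_add M0 (leq_mul (leqnn d) h).
  by rewrite add1n mulnCA -mulnS.
have [|c [e ce] cR] := msize_bounded_dependent RB.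
  rewrite card_ffun !card_ord.
  apply: (@leq_trans (M ^ m.+1)); last by rewrite leq_pexp2l.
  by rewrite expnMn expnS mulnC ltn_pmul2r ?expn_gt0.
pose mon (f : {ffun 'I_d -> 'I_M}) : 'X_{1..d} := [multinom (f i : nat) | i < d].
have mon_inj : injective mon.
  move=> f g /mnmP fg; apply/ffunP => i; apply/val_inj.
  by have := fg i; rewrite !mnmE.
exists (\sum_f c f *: 'X_[mon f]).
  apply/eqP => F0; have := congr1 (mcoeff (mon e)) F0.
  rewrite mcoeff0 raddf_sum /= (bigD1 e) //= mcoeffZ mcoeffX eqxx mulr1.
  rewrite big1 ?addr0; first by apply/eqP.
  by move=> f fe; rewrite mcoeffZ mcoeffX (inj_eq mon_inj) (negPf fe) mulr0.
move=> v Qv; apply: (mulfI (expf_neq0 (M * d) Qv)); rewrite mulr0.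
rewrite -[RHS](meval0 v) -cR !raddf_sum mulr_sumr /=.
apply: eq_bigr => f _; rewrite !mevalZ mevalX mulrCA; congr (_ * _).
rewrite /R rmorph_prod /= exprM -[X in _ ^+ X]card_ord -prodr_const -big_split /=.
apply: eq_bigr => i _; rewrite mnmE mevalM !rmorphXn /= expr_div_n mulrCA.
congr (_ * _); apply: (mulIf (expf_neq0 (f i) Qv)).
by rewrite mulfVK ?expf_neq0 // -exprD subnK // ltnW.
Qed.

End AlgebraicDependence.

(** * Finite dimensional commutative algebras *)

Section CommutativeAlgebra.
Variables (K : closedFieldType) (A : falgType K).
Hypothesis hK : [pchar K] =i pred0.
Hypothesis hc : alg_commutative A.

Lemma natr_neq0 n : (0 < n)%N -> n%:R != 0 :> K.
Proof. by have /pcharf0P -> := hK; rewrite -lt0n. Qed.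

Definition alg_nilp (a : A) := exists k, a ^+ k = 0.

Lemma exprMc (a b : A) k : (a * b) ^+ k = a ^+ k * b ^+ k.
Proof. exact/exprMn_comm/hc. Qed.

Lemma nilp_mul (a b : A) : alg_nilp a -> alg_nilp (a * b).
Proof. by case=> k ak; exists k; rewrite exprMc ak mul0r. Qed.

Lemma unit_cancel (a b : A) : a * b = 1 -> a \is a GRing.unit.
Proof. by move=> ab; apply/unitrP; exists b; rewrite hc. Qed.

Definition palg (a : A) (p : {poly K}) : A := (map_poly (in_alg A) p).[a].

Lemma palg_relation (a : A) : exists2 p : {poly K}, p != 0 & palg a p = 0.
Proof.
pose n := \dim {:A}.
have [|c [i ci] cR] := @nonzero_relation K 'I_n.+1 'I_n
    (fun i j => coord (vbasis {:A}) j (a ^+ i)); first by rewrite !card_ord.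
exists (\poly_(i < n.+1) c (inord i)).
  apply/eqP => p0; have := congr1 (fun p : {poly K} => p`_i) p0.
  by rewrite coef_poly coef0 ltn_ord inord_val; apply/eqP.
rewrite /palg (horner_coef_wide (n := n.+1)); last first.
  by apply: leq_trans (size_poly _ _) _; apply: size_poly.
rewrite [LHS](coord_vbasis (memvf _)) big1 // => j _.
apply/eqP; rewrite scaler_eq0; apply/orP; left; apply/eqP.
rewrite linear_sum -[RHS](cR j); apply: eq_bigr => l _; rewrite coef_map coef_poly ltn_ord inord_val /=.
by rewrite mulr_algl linearZ.
Qed.

Lemma palgM a p q : palg a (p * q) = palg a p * palg a q.
Proof. by rewrite /palg rmorphM hornerM_comm //; apply: hc. Qed.

Lemma palgXsubC a c : palg a ('X - c%:P) = a - c%:A.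
Proof. by rewrite /palg rmorphB /= map_polyX map_polyC hornerXsubC. Qed.

Lemma palgC a c : palg a c%:P = c%:A.
Proof. by rewrite /palg map_polyC hornerC. Qed.

Lemma palgD a p q : palg a (p + q) = palg a p + palg a q.
Proof. by rewrite /palg rmorphD hornerD. Qed.

Lemma palgX a k : palg a ('X^k) = a ^+ k.
Proof. by rewrite /palg map_polyXn hornerXn. Qed.

Lemma palgXn a p k : palg a (p ^+ k) = palg a p ^+ k.
Proof.
elim: k => [|k IH]; first by rewrite !expr0 -polyC1 palgC scale1r.
by rewrite !exprS palgM IH.
Qed.

(** Dividing [p - p.[c]] by ['X - c] and evaluating at [a] yields an inverse of [a - c], up to the
    scalar [- p.[c]]. *)
Lemma annihilated_unit (a : A) p c :
  palg a p = 0 -> p.[c] != 0 -> a - c%:A \is a GRing.unit.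
Proof.
move=> pa pc; have /factor_theorem[q qE] : root (p - p.[c]%:P) c.
  by rewrite rootE !hornerE subrr.
move/(congr1 (palg a)): qE.
rewrite palgM palgXsubC -rmorphN palgD pa palgC add0r hc => E.
apply: (@unit_cancel _ ((- p.[c])^-1 *: palg a q)).
by rewrite -scalerAr -E scalerA mulVf ?scale1r // oppr_eq0.
Qed.

(** Any [c] outside the roots of an annihilating polynomial works. Facts about units thereby extend
    linearly to the whole algebra. *)
Lemma unit_shift (a : A) : exists2 c : K, c != 0 & a - c%:A \is a GRing.unit.
Proof.
have [p p0 pa] := palg_relation a.
have /closed_nonrootP[c] : 'X * p != 0 by rewrite mulf_neq0 ?polyX_eq0.
rewrite rootE hornerM hornerX mulf_eq0 negb_or => /andP[c0 pc].
by exists c => //; apply: annihilated_unit pa pc.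
Qed.

Lemma nilp_unit (a : A) (c : K) : c != 0 -> alg_nilp (a - c%:A) ->
  a \is a GRing.unit.
Proof.
move=> c0 [k ak]; rewrite -[a]subr0 -(scale0r 1).
apply: (@annihilated_unit a (('X - c%:P) ^+ k)).
  by rewrite palgXn palgXsubC.
by rewrite horner_exp hornerXsubC sub0r expf_neq0 // oppr_eq0.
Qed.

(** Write an annihilating polynomial as [q * 'X^m] with [q.[0] != 0], and [q] as [s * 'X + q.[0]];
    then solve for [a ^+ m]. *)
Lemma fitting (a : A) : exists m c, a ^+ m = a ^+ m.+1 * c.
Proof.
have [p p0 pa] := palg_relation a.
have [m [q q0 pE]] := multiplicity_XsubC p 0.
rewrite p0 /root /= in q0.
have /factor_theorem[s sE] : root (q - q.[0]%:P) 0.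
  by rewrite rootE !hornerE subrr.
have qa : palg a q = palg a s * a + q.[0]%:A.
  by rewrite -{1}(subrK q.[0]%:P q) sE subr0 palgD palgM palgC -['X]expr1 palgX.
exists m, (- q.[0]^-1 *: palg a s).
move: pa; rewrite pE palgM subr0 palgX qa mulrDl mulr_algl => E.
have {}E : q.[0] *: a ^+ m = - (a ^+ m.+1 * palg a s).
  by apply/eqP; rewrite -addr_eq0 addrC exprS [a * _ * _]hc mulrA E.
by rewrite -scalerAr scaleNr -scalerN -E scalerA mulVf ?scale1r.
Qed.

(** Minimality for the order [g * e = g] on idempotents; that [e] is itself a nonzero idempotent is
    a separate hypothesis. *)
Definition primitive (e : A) :=
  forall g, g * g = g -> g * e = g -> g = 0 \/ g = e.

(** The powers of [b] stabilize, which produces an idempotent [g] below [e] that fixes [b ^+ m.+1].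
    If [g = 0] then [b] is nilpotent; if [g = e] then [b] is invertible in the corner of [e]. *)
Lemma primitive_dichotomy (e b : A) : e * e = e -> primitive e -> b * e = b ->
  alg_nilp b \/ exists c, b * c = e.
Proof.
move=> ee pe be; have [[|m] [c mc]] := fitting b.
  right; exists (c * e); rewrite expr0 expr1 in mc.
  by rewrite mulrA -mc mul1r.
have mk k : b ^+ m.+1 = b ^+ (m.+1 + k) * c ^+ k.
  elim: k => [|k IH]; first by rewrite addn0 mulr1.
  by rewrite {1}mc exprSr {1}IH -!mulrA [c ^+ k * _]hc -!mulrA [c * _]hc -exprSr
    mulrA -exprSr addnS.
pose g := b ^+ m.+1 * c ^+ m.+1.
have gb : b ^+ m.+1 = b ^+ m.+1 * g by rewrite /g mulrA -exprD -mk.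
have gg : g * g = g by rewrite {1}/g -mulrA [_ * g]hc mulrA -gb.
have ge : g * e = g by rewrite /g exprSr -!mulrA [_ * e]hc [b * _]mulrA be.
case: (pe g gg ge) => gE.
  by left; exists m.+1; rewrite gb gE mulr0.
by right; exists (b ^+ m * c ^+ m.+1); rewrite mulrA -exprS.
Qed.

(** An annihilating polynomial of [a] splits into linear factors. Were all of them invertible in the
    corner of [e], so would be their product, which is 0. *)
Lemma primitive_eigenvalue (e a : A) : e * e = e -> e != 0 -> primitive e ->
  exists c : K, alg_nilp ((a - c%:A) * e).
Proof.
move=> ee e0 pe; have [p p0 pa] := palg_relation a.
have [s pE] := closed_field_poly_normal p.
apply: NNPP => H; have inv (c : K) : exists b, (a - c%:A) * e * b = e.
  case: (@primitive_dichotomy e ((a - c%:A) * e)) => //; first by rewrite -mulrA ee.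
  by move=> h; case: H; exists c.
have [b bE] : exists b, palg a (\prod_(z <- s) ('X - z%:P)) * b * e = e.
  elim: s {pE} => [|z s [b IH]]; first by exists 1; rewrite big_nil palgC scale1r !mul1r.
  rewrite big_cons palgM palgXsubC; have [b' b'E] := inv z.
  exists (b * b'); set P := palg a _ in IH *.
  by rewrite [X in X * _ * _]hc mulrA -[P * _ * b]mulrA [_ * b]hc !mulrA
    -mulrA -[X in X * _]mulrA [b' * e]hc !mulrA -[P * b * _ * e]mulrA [_ * e]hc !mulrA IH
    -[e * _]hc.
have l0 : lead_coef p != 0 by rewrite lead_coef_eq0.
move: pa; rewrite pE -mul_polyC palgM palgC mulr_algl => /eqP.
rewrite scaler_eq0 (negPf l0) /= => /eqP P0.
by case/eqP: e0; rewrite -bE P0 !mul0r.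
Qed.

(** Induction on the dimension of the ideal generated by [f]: an idempotent [f] that is not
    primitive splits as [e + (f - e)], and both summands generate strictly smaller ideals. *)
Lemma primitive_decomposition_seq n (f : A) : f * f = f ->
  (\dim (limg (amull f)) <= n)%N ->
  exists s : seq A,
    [/\ forall x, x \in s -> [/\ x * x = x, x != 0, x * f = x & primitive x],
        pairwise (fun x y => x * y == 0) s & \sum_(x <- s) x = f].
Proof.
elim: n f => [|n IH] f ff df.
  have f0 : f = 0.
    apply/eqP; rewrite -memv0; move: df; rewrite leqn0 dimv_eq0 => /eqP <-.
    by apply/memv_imgP; exists 1; rewrite ?memvf // lfunE /= mulr1.
  by exists [::]; split=> //; rewrite big_nil f0.
have [f0|f0] := eqVneq f 0.
  by exists [::]; split=> //; rewrite big_nil f0.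
have [pf|] := classic (primitive f).
  exists [:: f]; split=> //; last by rewrite big_seq1.
  by move=> x; rewrite inE => /eqP ->.
move=> npf; have [e He] := not_all_ex_not _ _ npf.
have [ee {}He] := imply_to_and _ _ He; have [ef {}He] := imply_to_and _ _ He.
have [e0 nef] := not_or_and _ _ He.
have small g : g * g = g -> g * f = g -> g <> f -> (\dim (limg (amull g)) <= n)%N.
  move=> gg gf ngf; rewrite -ltnS; apply: leq_trans df.
  have sub : (limg (amull g) <= limg (amull f))%VS.
    apply/subvP => _ /memv_imgP[x _ ->]; rewrite lfunE /=.
    by apply/memv_imgP; exists (g * x); rewrite ?memvf // lfunE /= mulrA [f * g]hc gf.
  rewrite ltn_neqAle dimvS // andbT.
  have [_ ->] := dimv_leqif_eq sub; apply/eqP => E; apply: ngf.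
  have : f \in limg (amull g).
    by rewrite E; apply/memv_imgP; exists 1; rewrite ?memvf // lfunE /= mulr1.
  case/memv_imgP => x _; rewrite lfunE /= => fx.
  by rewrite -gf fx mulrA gg.
pose e' := f - e.
have fe : f * e = e by rewrite hc.
have ee' : e * e' = 0 by rewrite mulrBr ef ee subrr.
have e'e' : e' * e' = e' by rewrite {1}/e' mulrBl ee' subr0 mulrBr ff fe.
have e'f : e' * f = e' by rewrite mulrBl ff ef.
have [s [sP so sS]] := IH e ee (small _ ee ef nef).
have ne'f : e' <> f by move=> E; apply: e0; rewrite -[e](subKr f) -/e' E subrr.
have [s' [s'P s'o s'S]] := IH e' e'e' (small _ e'e' e'f ne'f).
exists (s ++ s'); split.
- move=> x; rewrite mem_cat => /orP[/sP|/s'P] [xx x0 xe px]; split=> //.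
    by rewrite -xe -mulrA ef.
  by rewrite -xe -mulrA e'f.
- rewrite pairwise_cat so s'o !andbT; apply/allrelP => x y /sP[_ _ xe _] /s'P[_ _ ye _].
  by rewrite -xe -ye [y * _]hc mulrA -[x * e * _]mulrA ee' mulr0 mul0r.
- by rewrite big_cat /= sS s'S /e' addrC subrK.
Qed.

Record prim_decomp k (e : 'I_k -> A) : Prop := PrimDecomp {
  pd_orth : forall i j, e i * e j = if i == j then e i else 0;
  pd_neq0 : forall i, e i != 0;
  pd_sum : \sum_i e i = 1;
  pd_prim : forall i, primitive (e i) }.

Lemma primitive_decomposition : exists k (e : 'I_k -> A), prim_decomp e.
Proof.
have [s [sP so sS]] := primitive_decomposition_seq (mulr1 1) (leqnn _).
have sm (i : 'I_(size s)) : s`_i \in s by rewrite mem_nth.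
exists (size s), (fun i => s`_i); split=> [i j|i||i].
- wlog ij : i j / (i <= j)%N.
    move=> W; case/orP: (leq_total i j) => h; first exact: W.
    by rewrite hc W // eq_sym; case: eqP => [->|].
  case: eqP => [->|ne]; first by have [] := sP _ (sm j).
  have lt_ij : (i < j)%N.
    by rewrite ltn_neqAle ij andbT; apply/eqP => /val_inj.
  by apply/eqP; apply: (pairwiseP 0 so); rewrite ?inE ?ltn_ord.
- by have [] := sP _ (sm i).
- by rewrite -[RHS]sS (big_nth 0) big_mkord.
- by have [] := sP _ (sm i).
Qed.

(** The count of [2 ^ k] square roots of 1, phrased as an indexing because [A] is not a finite type.
    Idempotents, local summands and the group are compared through it. *)
Definition involutions_indexed k :=
  exists2 w : {ffun 'I_k -> bool} -> A, injective w
    & forall u, u * u = 1 <-> exists b, u = w b.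

Lemma involutions_indexed_uniq k l :
  involutions_indexed k -> involutions_indexed l -> k = l.
Proof.
move=> [w wi wP] [w' w'i w'P].
have [g gE] : exists g, forall b, w b = w' (g b).
  apply: (fin_all_exists (P := fun b c => w b = w' c)) => b.
  by have /wP/w'P : exists b', w b = w b' by exists b.
have [h hE] : exists g, forall b, w' b = w (g b).
  apply: (fin_all_exists (P := fun b c => w' b = w c)) => b.
  by have /w'P/wP : exists b', w' b = w' b' by exists b.
have : bijective g.
  exists h => b; first by apply: wi; rewrite -hE -gE.
  by apply: w'i; rewrite -gE -hE.
move/bij_eq_card; rewrite !card_ffun !card_bool !card_ord => /eqP.
by rewrite eqn_exp2l // => /eqP.
Qed.

Lemma prim_decomp_involutions k (e : 'I_k -> A) :
  prim_decomp e -> involutions_indexed k.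
Proof.
case=> eo e0 eS pe.
pose w (b : {ffun 'I_k -> bool}) := \sum_i (-1) ^+ b i * e i.
have we b i : w b * e i = (-1) ^+ b i * e i.
  rewrite mulr_suml (bigD1 i) //= -mulrA eo eqxx big1 ?addr0 // => j ji.
  by rewrite -mulrA eo (negPf ji) mulr0.
have two : (2%:R : K) != 0 by exact: natr_neq0.
have sgn i (b c : bool) : (-1) ^+ b * e i = (-1) ^+ c * e i -> b = c.
  have H : e i <> - e i.
    move/eqP; rewrite -subr_eq0 opprK -mulr2n -scaler_nat scaler_eq0.
    by rewrite (negPf two) (negPf (e0 i)).
  by case: b c => [] [] //; rewrite expr0 expr1 mulN1r mul1r => E; case: H.
exists w => [b c bc|u].
  by apply/ffunP => i; apply: (sgn i); rewrite -!we bc.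
split=> [uu|[b ->]]; last first.
  rewrite {2}/w mulr_sumr -[RHS]eS; apply: eq_bigr => i _.
  rewrite mulrA [w b * _]hc -mulrA we mulrA.
  by rewrite -expr2 sqrr_sign mul1r.
have ue i : exists b : bool, u * e i = (-1) ^+ b * e i.
  (* For an involution [u], half of [1 + u] is idempotent; cut down to the corner of [e i] it is 0
     or [e i], which gives the sign -1 or 1. *)
  pose g := 2%:R^-1 *: (1 + u) * e i.
  have gg : g * g = g.
    rewrite /g -!scalerAl -!scalerAr scalerA.
    have -> : (1 + u) * e i * ((1 + u) * e i) = 2%:R *: ((1 + u) * e i).
      rewrite -mulrA [e i * _]hc -!mulrA eo eqxx mulrA scalerAl.
      congr (_ * _); rewrite mulrDr mulr1 mulrDl mul1r uu scaler_nat mulr2n.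
      by rewrite [u + 1]addrC.
    by rewrite scalerA -mulrA mulVf // mulr1.
  have ge : g * e i = g by rewrite /g -mulrA eo eqxx.
  have gE : 2%:R *: g = e i + u * e i.
    by rewrite /g -!scalerAl scalerA mulfV // scale1r mulrDl mul1r.
  case: (pe i g gg ge) => E; move: gE; rewrite E.
    rewrite scaler0 => /esym/eqP; rewrite addrC addr_eq0 => /eqP h.
    by exists true; rewrite h expr1 mulN1r.
  rewrite scaler_nat mulr2n => /addrI h.
  by exists false; rewrite -h expr0 mul1r.
have [b bE] := fin_all_exists ue.
exists [ffun i => b i]; rewrite -[LHS]mulr1 -eS mulr_sumr.
by apply: eq_bigr => i _; rewrite bE ffunE.
Qed.

End CommutativeAlgebra.

(** * Local summands *)

Section LocalAlgebra.
Variables (K : closedFieldType) (A : falgType K).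
Hypothesis hK : [pchar K] =i pred0.
Hypothesis hc : alg_commutative A.

Lemma ideal_proper (I : {vspace A}) : alg_ideal I ->
  I != {:A}%VS <-> 1 \notin I.
Proof.
move=> hI; split; last by apply: contra => /eqP ->; exact: memvf.
apply: contra => I1; apply/eqP/vspaceP => x.
by rewrite memvf -[x]mulr1 hI.
Qed.

Lemma ideal_maximal (I : {vspace A}) : alg_ideal I -> I != {:A}%VS ->
  exists2 M, alg_maximal_ideal M & (I <= M)%VS.
Proof.
have [n] := ubnP (\dim {:A} - \dim I).
elim: n I => // n IH I dI hI pI.
have [mI|nmI] := classic (alg_maximal_ideal I); first by exists I.
have [J [hJ IJ nJI nJA]] : exists J : {vspace A},
    [/\ alg_ideal J, (I <= J)%VS, J != I & J != {:A}%VS].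
  apply: NNPP => H; apply: nmI; split=> // J hJ IJ.
  have [->|JI] := eqVneq J I; first by left.
  have [->|JA] := eqVneq J {:A}%VS; first by right.
  by case: H; exists J.
have [|M mM JM] := IH J _ hJ nJA; last by exists M => //; apply: subv_trans JM.
have lt_IJ : (\dim I < \dim J)%N.
  rewrite ltn_neqAle dimvS // andbT.
  by have [_ ->] := dimv_leqif_eq IJ; rewrite eq_sym.
apply: leq_trans (_ : _ <= \dim {:A} - \dim I)%N _ => //.
by apply: ltn_sub2l => //; apply: leq_trans lt_IJ (dimvS (subvf _)).
Qed.

Lemma principal_ideal (a : A) : alg_ideal (limg (amull a)).
Proof.
move=> b _ /memv_imgP[x _ ->]; rewrite lfunE /=.
by apply/memv_imgP; exists (b * x); rewrite ?memvf // lfunE /= hc -mulrA [x * b]hc.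
Qed.

Lemma principal_ideal_proper (a : A) :
  (forall b, a * b <> 1) -> limg (amull a) != {:A}%VS.
Proof.
move=> na; apply/(ideal_proper (@principal_ideal a)).
by apply/negP => /memv_imgP[x _]; rewrite lfunE /= => /esym; apply: na.
Qed.

Lemma principal_ideal_gen (a : A) : a \in limg (amull a).
Proof. by apply/memv_imgP; exists 1; rewrite ?memvf // lfunE /= mulr1. Qed.

(** The sum of [1 + u] and [1 - u] is 2, so they are not both in the maximal ideal; as their product
    is 0, the invertible one makes the other vanish. *)
Lemma local_involution (u : A) : alg_local A -> u * u = 1 -> u = 1 \/ u = -1.
Proof.
move=> [_ [M [[iM /(ideal_proper iM) M1 _] Mu]]] uu.
have nonunit a : (forall b, a * b <> 1) -> a \in M.
  move=> /principal_ideal_proper pa.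
  have [M' mM' /subvP sM'] := ideal_maximal (@principal_ideal a) pa.
  by rewrite (Mu M') //; apply/sM'/principal_ideal_gen.
have uu0 : (1 - u) * (1 + u) = 0.
  by rewrite mulrDr mulr1 mulrBl uu mul1r addrA subrK subrr.
have [[b bE]|n1] := classic (exists b, (1 + u) * b = 1).
  left; apply/esym/eqP; rewrite -subr_eq0.
  by have := mulrA (1 - u) (1 + u) b; rewrite bE mulr1 uu0 mul0r => ->.
have [[b bE]|n2] := classic (exists b, (1 - u) * b = 1).
  right; apply/eqP; rewrite -addr_eq0 addrC.
  by have := mulrA (1 + u) (1 - u) b; rewrite bE mulr1 [_ * (1 - u)]hc uu0 mul0r => ->.
case/negP: M1; have two := @natr_neq0 K hK 2 isT.
have -> : 1 = (2%:R : K)^-1 *: ((1 + u) + (1 - u)).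
  by rewrite addrACA subrr addr0 -mulr2n -scaler_nat scalerA mulVf // scale1r.
apply: memvZ; apply: memvD; apply: nonunit => b bE.
  by apply: n1; exists b.
by apply: n2; exists b.
Qed.

(** A member of a maximal ideal is not a unit, so its [c] is 0 and it is nilpotent. When [1 = x + y]
    with [x] nilpotent, [y] is a unit; hence the sum of two maximal ideals is proper and equals
    both. *)
Lemma local_of_nilp : (forall a : A, exists c : K, alg_nilp (a - c%:A)) -> alg_local A.
Proof.
move=> H; split=> //.
have i0 : @alg_ideal K A 0%VS by move=> a x; rewrite !memv0 => /eqP ->; rewrite mulr0.
have [|M mM _] := ideal_maximal i0.
  by apply/(ideal_proper i0); rewrite memv0 oner_eq0.
exists M; split=> // M' mM'.
have nM (N : {vspace A}) (a : A) : alg_maximal_ideal N -> a \in N -> alg_nilp a.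
  move=> [iN /(ideal_proper iN) N1 _] aN; have [c nc] := H a.
  have [c0|c0] := eqVneq c 0; first by move: nc; rewrite c0 scale0r subr0.
  case/negP: N1; have := nilp_unit hc c0 nc => /mulVr <-.
  exact: iN.
have iMM' : alg_ideal (M + M')%VS.
  have [iM _ _] := mM; have [iM' _ _] := mM'.
  move=> a _ /memv_addP[x xM [y yM' ->]].
  by rewrite mulrDr memv_add // ?iM ?iM'.
have pMM' : (M + M')%VS <> {:A}%VS.
  apply/eqP/(ideal_proper iMM'); apply/negP => /memv_addP[x xM [y yM' xy]].
  have yu : y \is a GRing.unit.
    apply: (@nilp_unit _ _ hc _ 1); first exact: oner_neq0.
    rewrite scale1r xy opprD addrCA subrr addr0 -mulrN1.
    by apply: nilp_mul => //; apply: nM xM.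
  have [iM' /(ideal_proper iM') /negP + _] := mM'; apply.
  by rewrite -(mulVr yu) iM'.
have [_ _ uM] := mM; have [_ _ uM'] := mM'.
have [<-|//] := uM _ iMM' (addvSl _ _).
by have [|//] := uM' _ iMM' (addvSr _ _).
Qed.

End LocalAlgebra.

Section LocalSummands.
Variables (K : closedFieldType) (A : falgType K).
Hypothesis hK : [pchar K] =i pred0.
Hypothesis hc : alg_commutative A.

Lemma local_summands_involutions k :
  has_local_summands A k -> involutions_indexed A k.
Proof.
move=> [B [p [locB bijp]]].
have two : (2%:R : K) != 0 by exact: natr_neq0.
have injp (a b : A) : (forall i, p i a = p i b) -> a = b.
  by move=> E; have [c [_ cU]] := bijp (fun i => p i b); rewrite -(cU a) // -(cU b).
have /fin_all_exists[w wE] : forall b : {ffun 'I_k -> bool},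
    exists a : A, forall i, p i a = (-1) ^+ b i.
  by move=> b; have [a [aE _]] := bijp (fun i => (-1) ^+ b i); exists a.
exists w => [b c bc|u].
  apply/ffunP => i; have := congr1 (p i) bc; rewrite !wE.
  have H : (1 : B i) <> -1.
    move/eqP; rewrite -subr_eq0 opprK -mulr2n -scaler_nat scaler_eq0.
    by rewrite (negPf two) oner_eq0.
  by case: (b i) (c i) => [] [] //; rewrite expr0 expr1 => E; case: H.
split=> [uu|[b ->]]; last first.
  by apply: injp => i; rewrite rmorphM rmorph1 /= !wE -expr2 sqrr_sign.
have /fin_all_exists[b bE] : forall i, exists b : bool, p i u = (-1) ^+ b.
  move=> i; have [hB _] := locB i.
  have puu : p i u * p i u = 1 by rewrite -rmorphM uu rmorph1.
  case: (local_involution hK hB (locB i) puu) => ->.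
    by exists false.
  by exists true.
by exists [ffun i => b i]; apply: injp => i; rewrite wE ffunE.
Qed.

Section OfIdempotents.
Variables (k : nat) (e : 'I_k -> A).
Hypothesis he : prim_decomp e.

Let U i := limg (amull (e i)).

Lemma mem_summand i x : (x \in U i) = (e i * x == x).
Proof.
apply/memv_imgP/eqP => [[y _ ->]|<-].
  by rewrite lfunE /= mulrA (pd_orth he) eqxx.
by exists x; rewrite ?memvf // lfunE.
Qed.

Lemma summand_is_aspace i : is_aspace (U i).
Proof.
apply/andP; split.
  apply/has_algidP; exists (e i); split; last by
    move=> x; rewrite mem_summand => /eqP ex; rewrite [x * _]hc.
  - by rewrite mem_summand (pd_orth he) eqxx.
  - exact: pd_neq0 he i.
apply/prodvP => x y; rewrite !mem_summand => /eqP ex _.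
by rewrite mulrA ex.
Qed.

Let B i : {aspace A} := ASpace (summand_is_aspace i).

(** Exponent 0 is excluded: the unit of the summand is [e i], whereas the zeroth power in [A] is
    1. *)
Lemma val_summandX i (x : subvs_of (B i)) l : vsval (x ^+ l.+1) = vsval x ^+ l.+1.
Proof. by elim: l => [|l IH]; rewrite ?expr1 // exprS [RHS]exprS -IH. Qed.

Lemma val_summand1 i : vsval (1 : subvs_of (B i)) = e i.
Proof.
have eB : e i \in B i by rewrite mem_summand (pd_orth he) eqxx.
have := memv_algid (B i); rewrite mem_summand => /eqP.
by rewrite hc (algidl eB).
Qed.

Lemma summand_local i : alg_local (subvs_of (B i)).
Proof.
have hB : alg_commutative (subvs_of (B i)).
  by move=> x y; apply/val_inj/hc.
apply: local_of_nilp => // x.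
have ee : e i * e i = e i by rewrite (pd_orth he) eqxx.
have [c [l cl]] := primitive_eigenvalue hc (vsval x) ee (pd_neq0 he i) (@pd_prim _ _ _ _ he i).
exists c, l.+1; apply: val_inj; rewrite /= val_summandX.
have -> : vsval (x - c%:A) = (vsval x - c%:A) * e i.
  have := valP x; rewrite mem_summand => /eqP ex.
  rewrite mulrBl [vsval x * _]hc ex mulr_algl -val_summand1.
  by rewrite raddfB /= linearZ.
by rewrite exprS cl mulr0.
Qed.

Let pr i := linfun (vsproj (B i) \o amull (e i)).

Lemma val_pr i a : vsval (pr i a) = e i * a.
Proof.
rewrite lfunE /= vsprojK ?lfunE //=.
by apply/memv_imgP; exists a; rewrite ?memvf // lfunE.
Qed.

Lemma pr_is_ahom i : ahom_in {:A} (pr i).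
Proof.
apply/ahom_inP; split=> [x y _ _|]; apply: val_inj; rewrite /=.
  rewrite [RHS](_ : _ = vsval (pr i x) * vsval (pr i y)) // !val_pr.
  by rewrite -[RHS]mulrA [x * _]hc !mulrA (pd_orth he) eqxx -!mulrA [y * x]hc.
by rewrite val_pr mulr1 -[RHS]/(vsval (1 : subvs_of (B i))) val_summand1.
Qed.

Lemma prim_decomp_local_summands : has_local_summands A k.
Proof.
exists (fun i => subvs_of (B i)), (fun i => AHom (pr_is_ahom i)).
split=> [i|y]; first exact: summand_local.
have yE i : e i * vsval (y i) = vsval (y i).
  by have := valP (y i); rewrite mem_summand => /eqP.
exists (\sum_i vsval (y i)); split=> [i|a ay].
  apply: val_inj; rewrite /= val_pr mulr_sumr (bigD1 i) //= yE.
  rewrite big1 ?addr0 // => j ji.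
  by rewrite -yE mulrA (pd_orth he) eq_sym (negPf ji) mul0r.
rewrite -[RHS]mul1r -(pd_sum he) mulr_suml; apply: eq_bigr => i _.
by rewrite -ay /= val_pr.
Qed.

End OfIdempotents.
End LocalSummands.

(** * The model algebras *)

Section Equivalence.
Variable K : fieldType.

Lemma equivalentI (V W : vectType K) (H : 'End(V) -> Prop) (H' : 'End(W) -> Prop)
    (f : 'Hom(V, W)) (g : 'Hom(W, V)) :
  cancel f g -> cancel g f ->
  (forall h, H h -> H' (f \o h \o g)%VF) ->
  (forall h, H' h -> H (g \o h \o f)%VF) -> equivalent H H'.
Proof.
move=> fK gK HH' H'H; have f0 : lker f == 0%VS by apply/lker0P/(can_inj fK).
have fV : (f^-1 = g)%VF.
  by apply/lfunP => x; rewrite -{1}[x]gK lker0_lfunK.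
exists f; split; first by exists g.
move=> h; rewrite fV; split; first exact: HH'.
move/H'H; congr (H _); apply/lfunP => x.
by rewrite !comp_lfunE !fK.
Qed.

Lemma equivalentE (V W : vectType K) (H : 'End(V) -> Prop) (H' : 'End(W) -> Prop) :
  equivalent H H' -> exists (f : 'Hom(V, W)) (g : 'Hom(W, V)),
    [/\ cancel f g, cancel g f, forall h, H h -> H' (f \o h \o g)%VF &
        forall h, H' h -> H (g \o h \o f)%VF].
Proof.
case=> f [bf HH']; have f0 : lker f == 0%VS by apply/lker0P/bij_inj.
have fK := lker0_lfunK f0.
have gK : cancel (f^-1)%VF f by apply/(bij_can_sym bf).
exists f, (f^-1)%VF; split=> // h; first by move/HH'.
move=> H'h; apply/HH'; congr (H' _) : H'h; apply/lfunP => x.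
by rewrite !comp_lfunE !gK.
Qed.

Lemma equivalent_sym (V W : vectType K) (H : 'End(V) -> Prop) (H' : 'End(W) -> Prop) :
  equivalent H H' -> equivalent H' H.
Proof. by move/equivalentE => [f [g [fK gK HH' H'H]]]; apply: (equivalentI gK fK). Qed.

Lemma equivalent_trans (V W X : vectType K) (H : 'End(V) -> Prop)
    (H' : 'End(W) -> Prop) (H'' : 'End(X) -> Prop) :
  equivalent H H' -> equivalent H' H'' -> equivalent H H''.
Proof.
move/equivalentE => [f [g [fK gK HH' H'H]]].
move/equivalentE => [f' [g' [f'K g'K HH'' H''H]]].
apply: (@equivalentI _ _ _ _ (f' \o f)%VF (g \o g')%VF).
- by move=> x; rewrite !comp_lfunE f'K fK.
- by move=> x; rewrite !comp_lfunE gK g'K.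
- by move=> h /HH'/HH''; rewrite !comp_lfunA.
- by move=> h /H''H/H'H; rewrite !comp_lfunA.
Qed.

Lemma equivalent_dim (V W : vectType K) (H : 'End(V) -> Prop) (H' : 'End(W) -> Prop) :
  equivalent H H' -> \dim {:V} = \dim {:W}.
Proof.
move/equivalentE => [f [g [fK gK _ _]]].
have f0 : lker f == 0%VS by apply/lker0P/(can_inj fK).
rewrite -(limg_dim_eq (f := f)); last by rewrite (eqP f0) capv0.
congr (\dim _); apply/vspaceP => x; rewrite memvf.
by apply/memv_imgP; exists (g x); rewrite ?memvf ?gK.
Qed.

End Equivalence.

(* The algebra [K^r + K^s] with [K^s] of square zero and the [i]-th idempotent of
   [K^r] acting as the identity on the [j]-th coordinate of [K^s] iff [c j = i]. *)
Section Model.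
Variables (K : fieldType) (r s : nat).
Implicit Types (c : 'I_s -> 'I_r) (v w : 'rV[K]_(r + s)).

Definition mulc c v w : 'rV[K]_(r + s) :=
  row_mx (\row_i (v 0 (lshift s i) * w 0 (lshift s i)))
    (\row_j (v 0 (lshift s (c j)) * w 0 (rshift r j)
             + v 0 (rshift r j) * w 0 (lshift s (c j)))).

Lemma mulcEl c v w i :
  mulc c v w 0 (lshift s i) = v 0 (lshift s i) * w 0 (lshift s i).
Proof. by rewrite row_mxEl mxE. Qed.

Lemma mulcEr c v w j :
  mulc c v w 0 (rshift r j) = v 0 (lshift s (c j)) * w 0 (rshift r j)
                             + v 0 (rshift r j) * w 0 (lshift s (c j)).
Proof. by rewrite row_mxEr mxE. Qed.

Lemma eq_rV_split v w : (forall i, v 0 (lshift s i) = w 0 (lshift s i)) ->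
  (forall j, v 0 (rshift r j) = w 0 (rshift r j)) -> v = w.
Proof.
by move=> El Er; apply/rowP => l; case: (split_ordP l) => i ->.
Qed.

Lemma mulc_is_linear c v : linear (mulc c v).
Proof.
move=> a w w'; apply: eq_rV_split => i.
  by rewrite !(mulcEl, mxE); ring.
by rewrite !(mulcEr, mxE); ring.
Qed.
HB.instance Definition _ c v :=
  GRing.isLinear.Build K 'rV[K]_(r + s) 'rV[K]_(r + s) *:%R (mulc c v)
    (mulc_is_linear c v).

Lemma mulcC c v w : mulc c v w = mulc c w v.
Proof.
apply: eq_rV_split => i; first by rewrite !mulcEl mulrC.
by rewrite !mulcEr; ring.
Qed.

Lemma mulcA c u v w : mulc c u (mulc c v w) = mulc c (mulc c u v) w.
Proof.
apply: eq_rV_split => i; first by rewrite !mulcEl mulrA.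
by rewrite !(mulcEr, mulcEl); ring.
Qed.

Definition onec : 'rV[K]_(r + s) := row_mx (const_mx 1) 0.

Lemma onecEl i : onec 0 (lshift s i) = 1.
Proof. by rewrite row_mxEl mxE. Qed.

Lemma onecEr j : onec 0 (rshift r j) = 0.
Proof. by rewrite row_mxEr mxE. Qed.

Lemma mul1c c v : mulc c onec v = v.
Proof.
apply: eq_rV_split => i; rewrite !(mulcEl, mulcEr, onecEl, onecEr).
  by rewrite mul1r.
by rewrite mul1r mul0r addr0.
Qed.

Definition cunit v := forall i, v 0 (lshift s i) != 0.

(** The expansion [1 / (a + x) = 1 / a - x / a ^ 2], exact because [x] has square zero. *)
Definition invc c v : 'rV[K]_(r + s) :=
  row_mx (\row_i (v 0 (lshift s i))^-1)
    (\row_j - (v 0 (rshift r j) / v 0 (lshift s (c j)) ^+ 2)).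

Lemma mulcV c v : cunit v -> mulc c v (invc c v) = onec.
Proof.
move=> vu; apply: eq_rV_split => i.
  by rewrite mulcEl onecEl /invc row_mxEl mxE mulfV.
rewrite mulcEr onecEr /invc row_mxEl row_mxEr !mxE.
by field; apply: vu.
Qed.

Lemma cunitP c v : cunit v <-> exists w, mulc c v w = onec.
Proof.
split=> [vu|[w vw] i]; first by exists (invc c v); apply: mulcV.
have := congr1 (fun x : 'rV_(r + s) => x 0 (lshift s i)) vw.
rewrite mulcEl onecEl => E; apply/eqP => v0.
by move: E; rewrite v0 mul0r => /esym/eqP; rewrite oner_eq0.
Qed.

Definition model_group c (h : 'End('rV[K]_(r + s))) :=
  exists2 v, cunit v & h = linfun (mulc c v).

End Model.

Lemma model_equivalent (K : fieldType) r s s' (c : 'I_s -> 'I_r) (c' : 'I_s' -> 'I_r)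
    (f : 'Hom('rV[K]_(r + s), 'rV[K]_(r + s'))) (g : 'Hom(_, _)) :
  cancel f g -> cancel g f ->
  (forall v w, f (mulc c v w) = mulc c' (f v) (f w)) ->
  equivalent (model_group (K := K) c) (model_group (K := K) c').
Proof.
move=> fK gK fM.
have gM v w : g (mulc c' v w) = mulc c (g v) (g w).
  by apply: (can_inj fK); rewrite fM !gK.
have f1 : f (onec K r s) = onec K r s'.
  have := fM (onec K r s) (g (onec K r s')).
  by rewrite mul1c gK mulcC mul1c => <-.
have g1 : g (onec K r s') = onec K r s by rewrite -f1 fK.
apply: (equivalentI fK gK) => h [v vu ->].
  exists (f v).
    have [w vw] := proj1 (cunitP c v) vu.
    by apply/(cunitP c'); exists (f w); rewrite -fM vw.
  by apply/lfunP => x; rewrite !comp_lfunE !lfunE /= fM gK.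
exists (g v).
  have [w vw] := proj1 (cunitP c' v) vu.
  by apply/(cunitP c); exists (g w); rewrite -gM vw.
by apply/lfunP => x; rewrite !comp_lfunE !lfunE /= gM fK.
Qed.

Definition model_iso (K : fieldType) (A : falgType K) r s (c : 'I_s -> 'I_r) :=
  exists (f : 'Hom('rV[K]_(r + s), A)) (g : 'Hom(A, 'rV[K]_(r + s))),
    [/\ cancel f g, cancel g f, f (onec K r s) = 1 &
        forall v w, f (mulc c v w) = f v * f w].

Lemma model_iso_equivalent (K : fieldType) (A : falgType K) r s (c : 'I_s -> 'I_r) :
  alg_commutative A -> model_iso A c -> equivalent (model_group (K := K) c) (@unit_group K A).
Proof.
move=> hc [f [g [fK gK f1 fM]]].
apply: (equivalentI fK gK) => h.
  move=> [v vu ->]; exists (f v).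
    have [w vw] := proj1 (cunitP c v) vu.
    by apply/unitrP; exists (f w); rewrite hc -fM vw f1.
  by apply/lfunP => x; rewrite !comp_lfunE !lfunE /= fM gK.
move=> [u uu ->]; exists (g u).
  apply/(cunitP c); exists (g u^-1); apply: (can_inj fK).
  by rewrite fM !gK f1 mulrV.
by apply/lfunP => x; rewrite !comp_lfunE !lfunE /= -{1}[u]gK -fM fK.
Qed.

Lemma model_iso_dim (K : fieldType) (A : falgType K) r s (c : 'I_s -> 'I_r) :
  model_iso A c -> \dim {:A} = (r + s)%N.
Proof.
move=> [f [g [fK gK _ _]]].
have f0 : lker f == 0%VS by apply/lker0P/(can_inj fK).
rewrite -[RHS]mul1n -[RHS](dim_matrix K 1 (r + s)) -dimvf.
rewrite -(limg_dim_eq (f := f)); last by rewrite (eqP f0) capv0.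
congr (\dim _); apply/vspaceP => x; rewrite memvf.
by apply/esym/memv_imgP; exists (g x); rewrite ?memvf ?gK.
Qed.

(** * Recognizing the model in an algebra whose nilpotents have square zero *)

Section Structure.
Variables (K : closedFieldType) (A : falgType K).
Hypothesis hK : [pchar K] =i pred0.
Hypothesis hc : alg_commutative A.

Section Coordinates.
Variables (n : nat) (b : n.-tuple A).

Definition lincomb (v : 'rV[K]_n) : A := \sum_i v 0 i *: b`_i.

Lemma lincomb_is_linear : linear lincomb.
Proof.
move=> a v w; rewrite /lincomb scaler_sumr -big_split /=.
by apply: eq_bigr => i _; rewrite !mxE scalerDl scalerA.
Qed.
HB.instance Definition _ :=
  GRing.isLinear.Build K 'rV[K]_n A *:%R lincomb lincomb_is_linear.

Definition coord_row (x : A) : 'rV[K]_n := \row_i coord b i x.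

Lemma coord_row_is_linear : linear coord_row.
Proof. by move=> a x y; apply/rowP => i; rewrite !mxE linearP. Qed.
HB.instance Definition _ :=
  GRing.isLinear.Build K A 'rV[K]_n *:%R coord_row coord_row_is_linear.

Hypothesis bb : basis_of {:A} b.

Lemma lincombK : cancel lincomb coord_row.
Proof. by move=> v; apply/rowP => i; rewrite mxE coord_sum_free ?(basis_free bb). Qed.

Lemma coord_rowK : cancel coord_row lincomb.
Proof.
move=> x; rewrite [RHS](coord_basis bb (memvf x)).
by apply: eq_bigr => i _; rewrite mxE.
Qed.

End Coordinates.

(** The added vectors are members of [Y] itself, so they keep the special form that [Y] is chosen
    for. *)
Lemma extend_free (X Y : seq A) : free X ->
  exists Z, [/\ {subset Z <= Y}, free (X ++ Z) & (<<X ++ Z>> = <<X ++ Y>>)%VS].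
Proof.
elim: Y X => [|y Y IH] X fX; first by exists [::]; rewrite cats0.
have [yX|yX] := boolP (y \in <<X>>%VS).
  have [Z [ZY fZ sZ]] := IH X fX; exists Z; split=> //.
    by move=> z /ZY zY; rewrite inE zY orbT.
  rewrite sZ !span_cat span_cons addvA; congr (_ + _)%VS.
  by apply/esym/addv_idPl.
have [|Z [ZY fZ sZ]] := IH (rcons X y).
  by rewrite -cats1 (perm_free (permEl (perm_catC _ _))) /= free_cons yX.
exists (y :: Z); rewrite -!cat_rcons; split=> // z.
by rewrite !inE => /orP[->|/ZY ->] //; rewrite orbT.
Qed.

(** Polarization: the square of [a + b] is [2 a b], whose square is 0, so [a + b] is nilpotent and
    [2 a b] vanishes. *)
Lemma nilsq_mul0 (a b : A) : nilpotent_square_zero A ->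
  a * a = 0 -> b * b = 0 -> a * b = 0.
Proof.
move=> nA aa bb; have E : (a + b) ^+ 2 = 2%:R *: (a * b).
  by rewrite expr2 mulrDl !mulrDr aa bb add0r addr0 [b * a]hc scaler_nat mulr2n.
have : (a + b) ^+ 2 = 0.
  apply: nA; exists 4; rewrite (exprM _ 2 2) E expr2 -scalerAl -scalerAr.
  by rewrite -mulrA [b * _]hc -mulrA bb !mulr0 !scaler0.
move/eqP; rewrite E scaler_eq0 (negPf (natr_neq0 hK _)) //.
by move/eqP.
Qed.

(** The [l]-th basis vector is the sum over [i] of [chi i l] times [e i] and of the nilpotent
    [y (i, l)] of corner [i]. Completing the [e i] by some of these nilpotents gives a basis in
    which the [j]-th nilpotent belongs to a single corner [c j]. *)
Lemma model_structure k (e : 'I_k -> A) : prim_decomp e ->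
  nilpotent_square_zero A -> exists s (c : 'I_s -> 'I_k), model_iso A c.
Proof.
move=> he nA; have eo := pd_orth he.
have /fin_all_exists[chi chiP] (i : 'I_k) : exists chi : 'I_(\dim {:A}) -> K,
    forall l : 'I_(\dim {:A}), alg_nilp (((vbasis {:A})`_l - (chi l)%:A) * e i).
  apply: (fin_all_exists (P := fun (l : 'I_(\dim {:A})) c => alg_nilp (((vbasis {:A})`_l - c%:A) * e i))).
  move=> l; apply: primitive_eigenvalue => //.
  - by rewrite eo eqxx.
  - exact: pd_neq0 he i.
  - exact: @pd_prim _ _ _ _ he i.
pose X := [tuple e i | i < k].
pose y (p : 'I_k * 'I_(\dim {:A})) := ((vbasis {:A})`_p.2 - (chi p.1 p.2)%:A) * e p.1.
have Xe (i : 'I_k) : X`_i = e i by rewrite -tnth_nth tnth_mktuple.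
have fX : free X.
  apply/freeP => a aX i; apply/eqP; move: aX => /(congr1 (fun x => x * e i)).
  rewrite mul0r mulr_suml (bigD1 i) // big1 ?addr0 => [|j ji].
    rewrite Xe -scalerAl eo eqxx /= addr0 => /eqP.
    by rewrite scaler_eq0 (negPf (pd_neq0 he i)) orbF.
  by rewrite Xe -scalerAl eo (negPf ji) scaler0.
have [Z [ZY fZ sZ]] := extend_free (map y (enum {: 'I_k * 'I_(\dim {:A})})) fX.
have full : (<<X ++ Z>> = {:A})%VS.
  apply/vspaceP => x; rewrite memvf sZ (coord_vbasis (memvf x)).
  apply: memv_suml => l _; apply: memvZ; rewrite -[_`_l]mulr1 -(pd_sum he) mulr_sumr.
  apply: memv_suml => i _.
  rewrite -[_`_l](subrK (chi i l)%:A) mulrDl mulr_algl span_cat memvD //.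
    apply: (subvP (addvSr _ _)); apply: memv_span.
    by apply/mapP; exists (i, l); rewrite ?mem_enum.
  apply: (subvP (addvSl _ _)); apply/memvZ/memv_span.
  by rewrite -[e i](tnth_mktuple e) mem_tnth.
have bsize : size (X ++ Z) == (k + size Z)%N by rewrite size_cat size_tuple.
pose b := Tuple bsize.
have bb : basis_of {:A} b by apply/andP; split; [apply/eqP|].
have bX i : b`_(lshift (size Z) i) = e i.
  by rewrite -[LHS]/((X ++ Z)`_i) nth_cat size_tuple ltn_ord Xe.
have bZ j : b`_(rshift k j) = Z`_j.
  by rewrite -[LHS]/((X ++ Z)`_(k + j)) nth_cat size_tuple ltnNge leq_addr addKn.
have /fin_all_exists[c cP] (j : 'I_(size Z)) : exists i, Z`_j * e i = Z`_j.
  have /mapP[[i l] _ ->] := ZY _ (mem_nth 0 (ltn_ord j)).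
  by exists i; rewrite /y /= -mulrA eo eqxx.
have Z2 (j : 'I_(size Z)) : Z`_j * Z`_j = 0.
  have /mapP[[i l] _ ->] := ZY _ (mem_nth 0 (ltn_ord j)).
  by rewrite -expr2; apply: nA; apply: chiP.
have ZZ (j l : 'I_(size Z)) : Z`_j * Z`_l = 0 by apply: nilsq_mul0.
have Ze (j : 'I_(size Z)) i : Z`_j * e i = if i == c j then Z`_j else 0.
  by rewrite -(cP j) -mulrA eo eq_sym; case: eqP => // _; rewrite mulr0.
exists (size Z), c, (linfun (lincomb b)), (linfun (coord_row b)); split.
- by move=> v; rewrite !lfunE /= lincombK.
- by move=> v; rewrite !lfunE /= coord_rowK.
- rewrite lfunE /= /lincomb big_split_ord /= [X in _ + X]big1 ?addr0 => [|j _].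
    by rewrite -(pd_sum he); apply: eq_bigr => i _; rewrite onecEl bX scale1r.
  by rewrite onecEr scale0r.
move=> v w; rewrite !lfunE /=.
pose E (v : 'rV_(k + size Z)) := \sum_i v 0 (lshift (size Z) i) *: e i.
pose Y (v : 'rV_(k + size Z)) := \sum_j v 0 (rshift k j) *: Z`_j.
have lE u : lincomb b u = E u + Y u.
  rewrite /lincomb big_split_ord; congr (_ + _); apply: eq_bigr => i _.
    by rewrite bX.
  by rewrite bZ.
have EE u u' : E u * E u' = E (mulc c u u').
  rewrite /E mulr_suml; apply: eq_bigr => i _; rewrite mulr_sumr (bigD1 i) //=.
  rewrite big1 ?addr0 => [|j ji].
    by rewrite -scalerAl -scalerAr eo eqxx scalerA mulcEl.
  by rewrite -scalerAl -scalerAr eo eq_sym (negPf ji) !scaler0.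
have YE u u' : Y u * E u' = \sum_j (u 0 (rshift k j) * u' 0 (lshift _ (c j))) *: Z`_j.
  rewrite /Y mulr_suml; apply: eq_bigr => j _; rewrite mulr_sumr (bigD1 (c j)) //=.
  rewrite big1 ?addr0 => [|i ij].
    by rewrite -scalerAl -scalerAr Ze eqxx scalerA.
  by rewrite -scalerAl -scalerAr Ze (negPf ij) !scaler0.
have YY u u' : Y u * Y u' = 0.
  rewrite mulr_suml big1 // => j _; rewrite mulr_sumr big1 // => l _.
  by rewrite -scalerAl -scalerAr ZZ !scaler0.
rewrite !lE mulrDl !mulrDr EE YY addr0 -addrA; congr (_ + _).
rewrite [E v * _]hc !YE -big_split /=; apply: eq_bigr => j _.
by rewrite mulcEr -scalerDl [w 0 _ * _]mulrC.
Qed.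

End Structure.

(** * Diagonal normalization and equivalence of the models *)

Lemma diagonal_lker0 (K : fieldType) (V : vectType K) (b : seq V) (D : 'End(V)) :
  basis_of {:V} b -> diagonal_wrt b D -> lker D == 0%VS.
Proof.
move=> bb dD; rewrite -dimv_eq0 -(eqn_add2r (\dim (limg D))) add0n.
have := limg_ker_dim D {:V}; rewrite capfv => ->; apply/eqP; congr (\dim _).
apply/esym/eqP; rewrite eqEsubv subvf -{1}(span_basis bb); apply/span_subvP => v vb.
have [a a0 Dv] := dD v vb; apply/memv_imgP; exists (a^-1 *: v); first exact: memvf.
by rewrite linearZ /= Dv scalerA mulVf // scale1r.
Qed.

Lemma equivalent_normalized (K : fieldType) (V W : vectType K)
    (H : 'End(V) -> Prop) (H' : 'End(W) -> Prop) :
  equivalent H H' -> normalized_by_diagonal H -> normalized_by_diagonal H'.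
Proof.
move/equivalentE => [f [g [fK gK HH' H'H]]] [b bb hb].
have f0 : lker f == 0%VS by apply/lker0P/(can_inj fK).
have limf : limg f = {:W}%VS.
  apply/vspaceP => x; rewrite memvf; apply/memv_imgP.
  by exists (g x); rewrite ?memvf ?gK.
exists (map f b).
  by rewrite -limf; apply: limg_basis_of => //; rewrite (eqP f0) capv0.
move=> D dD.
have D'd : diagonal_wrt b (g \o D \o f)%VF.
  move=> v vb; have [a a0 Da] := dD _ (map_f f vb); exists a => //.
  by rewrite !comp_lfunE Da linearZ /= fK.
have D0 : lker D == 0%VS.
  apply: diagonal_lker0 dD; rewrite -limf; apply: limg_basis_of => //.
  by rewrite (eqP f0) capv0.
have D'0 : lker (g \o D \o f)%VF == 0%VS by apply: diagonal_lker0 D'd.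
have D'V : ((g \o D \o f)^-1 = g \o D^-1 \o f)%VF.
  apply/lfunP => x; apply: (lker0P D'0).
  by rewrite lker0_lfunVK // !comp_lfunE gK lker0_lfunVK // fK.
have tr h : ((g \o D \o f) \o (g \o h \o f) \o (g \o D \o f)^-1 =
    g \o (D \o h \o D^-1) \o f)%VF.
  by rewrite D'V; apply/lfunP => x; rewrite !comp_lfunE !gK.
have fg h : (f \o (g \o h \o f) \o g = h)%VF.
  by apply/lfunP => x; rewrite !comp_lfunE !gK.
move=> h; have := hb _ D'd (g \o h \o f)%VF; rewrite tr => E; split.
  by move/H'H/E/HH'; rewrite fg.
by move/H'H/E/HH'; rewrite fg.
Qed.

Section DiagonalModel.
Variables (K : fieldType) (r s : nat) (c : 'I_s -> 'I_r).

Lemma diagonal_std_basis n : basis_of {:'rV[K]_n} [seq delta_mx 0 i | i <- enum 'I_n].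
Proof.
rewrite basisEdim; apply/andP; split.
  apply/subvP => v _; rewrite [v]row_sum_delta; apply: memv_suml => i _.
  by apply/memvZ/memv_span/map_f; rewrite mem_enum.
by rewrite size_map size_enum_ord dimvf dim_matrix mul1r.
Qed.

(** In the standard basis, conjugation by a diagonal [d] fixes the idempotent coordinates of [v] and
    scales the [j]-th nilpotent one by the ratio of the entries of [d] at [j] and at [c j]. *)
Lemma model_normalized : normalized_by_diagonal (model_group (K := K) c).
Proof.
exists [seq delta_mx 0 i | i <- enum 'I_(r + s)]; first exact: diagonal_std_basis.
move=> D dD.
have /fin_all_exists2[d d0 dE] (i : 'I_(r + s)) : exists2 a : K, a != 0 &
    D (delta_mx 0 i) = a *: delta_mx 0 i.
  by apply: dD; apply/map_f; rewrite mem_enum.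
have DE v i : D v 0 i = d i * v 0 i.
  rewrite {1}[v]row_sum_delta linear_sum summxE (bigD1 i) //= big1 ?addr0 => [|j ji].
    by rewrite linearZ /= dE !mxE !eqxx /= mulr1 mulrC.
  by rewrite linearZ /= dE !mxE eq_sym (negPf ji) !mulr0.
have D0 : lker D == 0%VS.
  apply/lker0P => v w vw; apply/rowP => i; apply: (mulfI (d0 i)).
  by rewrite -!DE vw.
have DVE v i : (D^-1)%VF v 0 i = (d i)^-1 * v 0 i.
  by apply: (mulfI (d0 i)); rewrite -DE mulrA mulfV // mul1r lker0_lfunVK.
(* Stated for any pair of mutually inverse diagonals, so that it serves for [D] and for its
   inverse. *)
have twist (D1 D2 : 'End('rV[K]_(r + s))) (a : 'I_(r + s) -> K) v :
    (forall i, a i != 0) -> (forall w i, D1 w 0 i = a i * w 0 i) ->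
    (forall w i, D2 w 0 i = (a i)^-1 * w 0 i) -> cunit v ->
    model_group c (D1 \o linfun (mulc c v) \o D2)%VF.
  move=> a0 D1E D2E vu.
  exists (row_mx (\row_i v 0 (lshift s i))
    (\row_j (a (rshift r j) / a (lshift s (c j)) * v 0 (rshift r j)))).
    by move=> i; rewrite row_mxEl mxE.
  apply/lfunP => w; rewrite !comp_lfunE !lfunE /=; apply: eq_rV_split => i.
    by rewrite D1E !mulcEl row_mxEl mxE D2E; field.
  by rewrite D1E !mulcEr row_mxEl row_mxEr !mxE !D2E; field; rewrite !a0.
move=> h; split=> [[v vu ->]|[v vu E]]; first exact: twist d0 DE DVE vu.
have -> : h = (D^-1 \o linfun (mulc c v) \o D)%VF.
  rewrite -E; apply/lfunP => w.
  by rewrite !comp_lfunE !lker0_lfunK.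
apply: (@twist _ _ (fun i => (d i)^-1)) => // [i|w i].
  by rewrite invr_eq0.
by rewrite invrK.
Qed.

End DiagonalModel.

(** * Fibre sizes as a complete invariant of the models *)

Definition fiber_size r s (c : 'I_s -> 'I_r) i := #|[set j | c j == i]|.

Definition fib_equiv r s (c c' : 'I_s -> 'I_r) :=
  exists p : 'S_r, forall i, fiber_size c i = fiber_size c' (p i).

Lemma tuple_count (T : eqType) s (f : 'I_s -> T) a :
  count_mem a [tuple f j | j < s] = #|[set j | f j == a]|.
Proof.
rewrite -sum1_count big_map big_enum_cond /= -sum1_card.
by apply: eq_bigl => j; rewrite inE.
Qed.

(** Equal fibre sizes up to [p] make [p \o c] a rearrangement of [c'] by some permutation [q];
    permuting the idempotents by [p] and the nilpotent coordinates by [q] is then an algebra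
    isomorphism. *)
Lemma fib_equiv_model (K : fieldType) r s (c c' : 'I_s -> 'I_r) :
  fib_equiv c c' -> equivalent (model_group (K := K) c) (model_group (K := K) c').
Proof.
case=> p pE.
have : perm_eq [tuple p (c j) | j < s] [tuple c' j | j < s].
  apply/allP => a _ /=; rewrite !tuple_count.
  have := pE ((p^-1)%g a); rewrite permKV => E; apply/eqP; rewrite -[RHS]E.
  by apply: eq_card => j; rewrite !inE -[in RHS](inj_eq (@perm_inj _ p)) permKV.
move/tuple_permP => [q /val_inj qE].
have cE j : p (c j) = c' (q j).
  by have := congr1 (fun t => tnth t j) qE; rewrite !tnth_mktuple.
pose F (p : 'S_r) (q : 'S_s) (l : 'I_(r + s)) : 'I_(r + s) :=
  match split l with inl i => lshift s (p i) | inr j => rshift r (q j) end.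
have Fl a b i : F a b (lshift s i) = lshift s (a i).
  by rewrite /F (unsplitK (inl _ i)).
have Fr a b i : F a b (rshift r i) = rshift r (b i).
  by rewrite /F (unsplitK (inr _ i)).
pose f := linfun (mxsub id (F (p^-1)%g (q^-1)%g) : 'rV[K]_(r + s) -> 'rV[K]_(r + s)).
pose g := linfun (mxsub id (F p q) : 'rV[K]_(r + s) -> 'rV[K]_(r + s)).
apply: (@model_equivalent _ _ _ _ _ _ f g).
- by move=> v; apply: eq_rV_split => i; rewrite !lfunE /= !mxE !(Fl, Fr) permK.
- by move=> v; apply: eq_rV_split => i; rewrite !lfunE /= !mxE !(Fl, Fr) permKV.
have fE u l : f u 0 l = u 0 (F (p^-1)%g (q^-1)%g l) by rewrite lfunE /= mxE.
move=> v w; apply: eq_rV_split => i; rewrite fE !(Fl, Fr).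
  by rewrite !mulcEl !fE !Fl.
rewrite !mulcEr !fE !(Fl, Fr).
have -> // : (p^-1)%g (c' i) = c ((q^-1)%g i).
by apply: (@perm_inj _ p); rewrite permKV cE permKV.
Qed.

Lemma char_poly_tr (K : fieldType) n (M : 'M[K]_n) : char_poly M^T = char_poly M.
Proof.
rewrite /char_poly -det_tr; congr (\det _).
by rewrite /char_poly_mx raddfB /= tr_scalar_mx -map_trmx trmxK.
Qed.

Lemma char_poly_similar (K : fieldType) n (P Q M : 'M[K]_n) :
  P *m Q = 1%:M -> char_poly (P *m M *m Q) = char_poly M.
Proof.
move=> PQ; have PQp : map_mx polyC P *m map_mx polyC Q = 1%:M.
  by rewrite -map_mxM PQ map_mx1.
rewrite /char_poly.
have -> : char_poly_mx (P *m M *m Q) =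
    map_mx polyC P *m char_poly_mx M *m map_mx polyC Q.
  rewrite /char_poly_mx mulmxBr mulmxBl !map_mxM; congr (_ - _).
  by rewrite scalar_mxC -mulmxA PQp mulmx1.
by rewrite !det_mulmx mulrAC -det_mulmx PQp det1 mul1r.
Qed.

Section CharPolyModel.
Variables (K : fieldType) (r s : nat) (c : 'I_s -> 'I_r).

Definition spectrum (v : 'rV[K]_(r + s)) : seq K :=
  [seq v 0 (lshift s i) | i <- enum 'I_r] ++ [seq v 0 (lshift s (c j)) | j <- enum 'I_s].

Lemma char_poly_model v :
  char_poly (lin1_mx (linfun (mulc c v))) = \prod_(x <- spectrum v) ('X - x%:P).
Proof.
(* Multiplication by [v] is upper triangular on row vectors, whereas [is_trig_mx] means lower
   triangular. *)
rewrite -char_poly_tr.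
have E l m : (lin1_mx (linfun (mulc c v)))^T l m = mulc c v (delta_mx 0 m) 0 l.
  by rewrite mxE [LHS]mxE lfunE.
have ne i j : (lshift s i == rshift r j :> 'I_(r + s)) = false.
  by apply/eqP => /(congr1 val) /= E'; have := ltn_ord i; rewrite E' ltnNge leq_addr.
rewrite char_poly_trig; last first.
  apply/is_trig_mxP => l m lm; rewrite E.
  case: (split_ordP l) lm => i -> lm.
    rewrite mulcEl !mxE eqxx /=; case: eqP lm => [<-|_ _]; first by rewrite ltnn.
    by rewrite mulr0.
  rewrite mulcEr !mxE !eqxx /=; case: eqP lm => [<-|_]; first by rewrite ltnn.
  case: eqP => [<- /=|_ _]; last by rewrite !mulr0 addr0.
  by rewrite ltnNge ltnW // (leq_trans (ltn_ord _)) ?leq_addr.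
rewrite big_split_ord /spectrum big_cat /=.
congr (_ * _); rewrite big_map big_enum /=; apply: eq_bigr => i _; rewrite E.
  by rewrite mulcEl !mxE !eqxx mulr1.
by rewrite mulcEr !mxE !eqxx ne mulr0 addr0 mulr1.
Qed.

Lemma count_spectrum (v : 'rV[K]_(r + s)) a : count_mem a (spectrum v) =
  addn #|[set i | v 0 (lshift s i) == a]| #|[set j | v 0 (lshift s (c j)) == a]|.
Proof.
have H n (f : 'I_n -> K) : count_mem a (map f (enum 'I_n)) = #|[set j | f j == a]|.
  by rewrite -tuple_count.
by rewrite count_cat !H.
Qed.

Lemma count_spectrum_inj (v : 'rV[K]_(r + s)) i : injective (fun i => v 0 (lshift s i)) ->
  count_mem (v 0 (lshift s i)) (spectrum v) = (fiber_size c i).+1.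
Proof.
move=> vi; rewrite count_spectrum.
have -> : [set l | v 0 (lshift s l) == v 0 (lshift s i)] = [set i].
  by apply/setP => j; rewrite !inE (inj_eq vi).
rewrite cards1 add1n; congr _.+1.
by apply: eq_card => j; rewrite !inE (inj_eq vi).
Qed.

Lemma mem_spectrum (v : 'rV[K]_(r + s)) a : a \in spectrum v -> exists i, a = v 0 (lshift s i).
Proof.
rewrite mem_cat => /orP[] /mapP[i _ ->]; first by exists i.
by exists (c i).
Qed.

End CharPolyModel.

Lemma model_equivalent_fib (K : fieldType) (hK : [pchar K] =i pred0) r s
    (c c' : 'I_s -> 'I_r) :
  equivalent (model_group (K := K) c) (model_group (K := K) c') -> fib_equiv c c'.
Proof.
move/equivalentE => [f [g [fK gK HH' _]]]; have /pcharf0P nat0 := hK.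
(* Eigenvalues [1, ..., r]: distinct in characteristic zero, and starting at 1 so that [v] is a
   unit. *)
pose v : 'rV[K]_(r + s) := row_mx (\row_i i.+1%:R) 0.
have vE i : v 0 (lshift s i) = i.+1%:R by rewrite row_mxEl mxE.
have vi : injective (fun i => v 0 (lshift s i)).
  move=> i j /=; rewrite !vE; wlog ij : i j / (j <= i)%N.
    by move=> W; case/orP: (leq_total i j) => h e; [apply/esym|]; apply: W.
  move/eqP; rewrite -subr_eq0 -natrB // nat0 subSS subn_eq0 => ji.
  by apply/val_inj/eqP; rewrite eqn_leq ji.
have [v' _ hE] : model_group c' (f \o linfun (mulc c v) \o g)%VF.
  by apply: HH'; exists v => // i; rewrite vE nat0.
have peq : perm_eq (spectrum c v) (spectrum c' v').
  apply: prod_XsubC_eq; rewrite -!char_poly_model -hE.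
  rewrite (_ : lin1_mx (_ \o _)%VF =
    lin1_mx g *m lin1_mx (linfun (mulc c v)) *m lin1_mx f).
    rewrite char_poly_similar //; apply/row_matrixP => i.
    by rewrite !rowE mulmxA !mul_rV_lin1 /= gK mulmx1.
  by apply/row_matrixP => i; rewrite !rowE !mulmxA !mul_rV_lin1 /= !comp_lfunE.
have /fin_all_exists[q qE] i : exists j, v 0 (lshift s i) = v' 0 (lshift s j).
  apply: (@mem_spectrum _ _ _ c'); rewrite -(perm_mem peq) mem_cat.
  by apply/orP; left; apply/mapP; exists i; rewrite ?mem_enum.
have qi : injective q by move=> i j qij; apply: vi; rewrite /= !qE qij.
(* The [r] distinct values of [v] all occur among the [r] idempotent coordinates of [v'], which are
   therefore distinct too. *)
have v'i : injective (fun i => v' 0 (lshift s i)).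
  have [q' _ q'K] := injF_bij qi.
  by move=> i j /=; rewrite -[i]q'K -[j]q'K -!qE => /vi ->.
exists (perm qi) => i; rewrite permE; apply: succn_inj.
by rewrite -(count_spectrum_inj c i vi) -(count_spectrum_inj c' _ v'i) -qE (seq.permP peq).
Qed.

(** * Partitions *)

Section Partitions.
Local Open Scope nat_scope.

Lemma fiber_size_exists r s (m : 'I_r -> nat) : \sum_i m i = s ->
  exists c : 'I_s -> 'I_r, forall i, fiber_size c i = m i.
Proof.
move=> mS; pose l := flatten [seq nseq (m i) i | i <- enum 'I_r].
have lS : size l == s.
  rewrite size_flatten /shape -map_comp sumnE big_map big_enum /= -mS.
  by apply/eqP/eq_bigr => i _; rewrite size_nseq.
exists (tnth (Tuple lS)) => i; rewrite /fiber_size -tuple_count.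
have -> : [tuple tnth (Tuple lS) j | j < s] = Tuple lS.
  by apply: eq_from_tnth => j; rewrite tnth_mktuple.
rewrite /= count_flatten -map_comp sumnE big_map big_enum /= (bigD1 i) //=.
rewrite count_nseq /= eqxx mul1n big1 ?addn0 // => j ji.
by rewrite count_nseq /= (negPf ji) mul0n.
Qed.

Lemma sum_fiber_size r s (c : 'I_s -> 'I_r) : \sum_i fiber_size c i = s.
Proof.
rewrite -[RHS]card_ord -sum1_card (partition_big c predT) //=.
apply: eq_bigr => i _; rewrite /fiber_size -sum1_card.
by apply: eq_bigl => j; rewrite inE.
Qed.

Lemma map_val_tuple r n (t : r.-tuple 'I_n) :
  map val t = [tuple val (tnth t i) | i < r].
Proof. by rewrite -{1}(map_tnth_enum t) -map_comp. Qed.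

Definition partition_set r n := [set t : r.-tuple 'I_n.+1 |
  [&& sorted geq (map val t), all (leq 1) (map val t) & sumn (map val t) == n]].

Lemma partition_fibers r s t : t \in partition_set r (r + s) ->
  exists c : 'I_s -> 'I_r, forall i, (fiber_size c i).+1 = tnth t i.
Proof.
rewrite inE => /and3P[_ /allP t1 /eqP tS].
have t0 i : 0 < tnth t i by apply: t1; apply/map_f/mem_tnth.
have [|c cE] := @fiber_size_exists r s (fun i => (tnth t i : nat).-1).
  apply/eqP; rewrite -(eqn_add2l r) -[X in _ == X]tS sumnE big_map big_tuple.
  rewrite -{1}[r]card_ord -sum1_card -big_split /=; apply/eqP/eq_bigr => i _.
  by rewrite add1n prednK.
by exists c => i; rewrite cE prednK.
Qed.

Lemma fibers_partition r s (c : 'I_s -> 'I_r) :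
  exists2 t, t \in partition_set r (r + s) &
    exists p : 'S_r, forall i, (fiber_size c i).+1 = tnth t (p i).
Proof.
pose f := [tuple (fiber_size c i).+1 | i < r].
pose l := sort geq f.
have fl : perm_eq f l by rewrite perm_sym perm_sort.
have lS : size l = r by rewrite -(perm_size fl) size_tuple.
(* A part is at most [s.+1], hence at most [r + s] because an index in ['I_r] exists; this makes the
   [inord] below faithful. *)
have lr x : x \in l -> 0 < x <= r + s.
  rewrite -(perm_mem fl) => /mapP[i _ ->] /=.
  have : fiber_size c i <= s by rewrite -[s in _ <= s]card_ord max_card.
  by rewrite -ltnS => /leq_trans -> //; rewrite -add1n leq_add2r (leq_trans _ (ltn_ord i)).
pose t := [tuple (inord (nth 0 l i) : 'I_(r + s).+1) | i < r].
have tE : map val t = l.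
  apply: (@eq_from_nth _ 0); first by rewrite size_map size_tuple.
  rewrite size_map size_tuple => i ir; rewrite (nth_map ord0) ?size_tuple //.
  rewrite -[i]/(nat_of_ord (Ordinal ir)) -tnth_nth tnth_mktuple /= inordK //.
  have il : i < size l by rewrite lS.
  by have /andP[_] := lr _ (mem_nth 0 il).
exists t.
  rewrite inE tE sort_sorted; last by move=> x y; apply: leq_total.
  apply/and3P; split=> //; first by apply/allP => x /lr/andP[].
  rewrite -(perm_sumn fl) sumnE big_map big_enum /=.
  under eq_bigr do rewrite -add1n.
  by rewrite big_split /= sum_fiber_size sum1_card card_ord.
have tv : [tuple val (tnth t i) | i < r] = l :> seq nat.
  by rewrite -tE map_val_tuple.
have : perm_eq f [tuple val (tnth t i) | i < r] by rewrite tv.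
move/tuple_permP => [p /val_inj pE]; exists p => i.
by have := congr1 (fun u => tnth u i) pE; rewrite !tnth_mktuple.
Qed.

Lemma partition_inj r n (t t' : r.-tuple 'I_n.+1) (p : 'S_r) :
  t \in partition_set r n -> t' \in partition_set r n ->
  (forall i, tnth t i = tnth t' (p i) :> nat) -> t = t'.
Proof.
rewrite !inE => /and3P[ts _ _] /and3P[t's _ _] tt'.
apply/val_inj/(inj_map val_inj)/(sorted_eq _ _ ts t's).
- by move=> x y z /= yx xz; apply: leq_trans xz yx.
- by move=> x y /=; rewrite andbC => /anti_leq.
rewrite perm_sym; have E : map val t = [tuple tnth [tuple val (tnth t' i) | i < r] (p i) | i < r].
  rewrite map_val_tuple; congr tval; apply: eq_from_tnth => i.
  by rewrite !tnth_mktuple; apply: tt'.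
rewrite E perm_sym (_ : map val t' = [tuple val (tnth t' i) | i < r]).
  by apply/tuple_permP; exists p.
exact: map_val_tuple.
Qed.

End Partitions.

(** * Torus-stable commutative matrix algebras *)

Section TorusStableMatrices.
Variables (K : fieldType) (n : nat) (X : 'M[K]_n -> Prop).
Hypothesis hK : [pchar K] =i pred0.
Hypothesis X_lin : forall a M M', X M -> X M' -> X (a *: M + M').
Hypothesis X_comm : forall M M', X M -> X M' -> M *m M' = M' *m M.

Definition diag_conj (d : 'I_n -> K) (M : 'M[K]_n) : 'M[K]_n :=
  \matrix_(k, l) (d k / d l * M k l).

Hypothesis X_conj : forall d M, (forall k, d k != 0) -> X M -> X (diag_conj d M).

(* Projections onto the weight spaces of the diagonal torus, obtained from the
   conjugations by [diag(1, .., 2, .., 1)]. *)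
Lemma isolate_entry M i j : X M -> i != j -> X (M i j *: delta_mx i j).
Proof.
move=> XM ij; pose d i0 (k : 'I_n) : K := if k == i0 then 2%:R else 1.
have two : (2%:R : K) != 0 by have /pcharf0P -> := hK.
have three : (3%:R : K) != 0 by have /pcharf0P -> := hK.
have d0 i0 k : d i0 k != 0 by rewrite /d; case: (k == i0); rewrite ?oner_neq0.
(* Off the diagonal, conjugation by [d i] doubles row [i] and halves column [i]: [N] kills all other
   entries, and [R] also kills column [i], keeping 3/2 of row [i]. Conjugation by [d j] halves
   column [j] of [R], so [S] is -3/4 of the wanted matrix; the factor -4/3 is then written in the
   shape of [X_lin]. *)
pose N := (-1) *: M + diag_conj (d i) M.
pose R := (- 2%:R^-1) *: N + diag_conj (d i) N.
pose S := (-1) *: R + diag_conj (d j) R.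
have XN : X N by apply: X_lin => //; apply: X_conj.
have XR : X R by apply: X_lin => //; apply: X_conj.
have XS : X S by apply: X_lin => //; apply: X_conj.
have -> : M i j *: delta_mx i j = (- (4%:R / 3%:R) - 1) *: S + S.
  apply/matrixP => k l; rewrite !mxE /d.
  case: (eqVneq k i) => [->|ki]; last first.
    case: (eqVneq l i) => [->|li]; case: (eqVneq k j) => [->|kj];
      rewrite ?eqxx ?(negPf ij) ?(negPf li) /=; case: (eqVneq l j) => ?;
      rewrite ?mulr0n; field; rewrite ?two ?three ?oner_neq0 //.
  rewrite (negPf ij); case: (eqVneq l i) => [->|li].
    by rewrite ?(negPf ij) /=; field; rewrite ?two ?three ?oner_neq0.
  by case: (eqVneq l j) => [->|lj] /=; rewrite ?mulr1n ?mulr0n; field; rewrite ?two ?three ?oner_neq0.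
by apply: X_lin.
Qed.

(** The elementary matrix [delta_mx i j] commutes with [M]; row [i] of the two products is row [j]
    of [M] and a multiple of the [j]-th unit row. *)
Lemma offdiagonal_entry M i j : X M -> i != j -> M i j != 0 ->
  forall l, l != j -> M j l = 0.
Proof.
move=> XM ij Mij l lj; have XE := isolate_entry XM ij.
have := congr1 (fun B : 'M_n => B i l) (X_comm XE XM).
rewrite -scalemxAl -scalemxAr !mxE => /(mulfI Mij).
rewrite (bigD1 j) //= !mxE !eqxx mul1r big1 ?addr0 => [->|k kj].
  by rewrite big1 // => k _; rewrite !mxE (negPf lj) andbF mulr0.
by rewrite !mxE eqxx (negPf kj) mul0r.
Qed.

(** If [M i j] is nonzero off the diagonal, row [j] is zero off the diagonal. So the diagonal of a
    power consists of powers of the diagonal, which must vanish, and no product [M i j * M j l]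
    survives. *)
Lemma torus_stable_nilpotent M k : X M -> M ^+ k = 0 -> M *m M = 0.
Proof.
move=> XM Mk.
have row_pow l q : (forall m, m != l -> M l m = 0) ->
    forall m, m != l -> (M ^+ q) l m = 0.
  move=> Ml; elim: q => [|q IH] m ml.
    by rewrite expr0 -[1]/(1%:M) mxE eq_sym (negPf ml).
  rewrite exprS -mulmxE mxE (bigD1 l) //= IH // mulr0 add0r big1 // => p pl.
  by rewrite Ml // mul0r.
have diag_pow i q : (M ^+ q) i i = M i i ^+ q.
  elim: q => [|q IH]; first by rewrite !expr0 -[1]/(1%:M) mxE eqxx.
  rewrite exprS -mulmxE mxE (bigD1 i) //= IH -exprS big1 ?addr0 // => l li.
  have [->|Mil] := eqVneq (M i l) 0; first by rewrite mul0r.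
  rewrite row_pow ?mulr0 // 1?eq_sym //.
  by apply: offdiagonal_entry XM _ Mil; rewrite eq_sym.
have diag0 i : M i i = 0.
  by apply/eqP; have := diag_pow i k; rewrite Mk mxE => /esym/eqP; rewrite expf_eq0 => /andP[].
apply/matrixP => i l; rewrite !mxE big1 // => j _.
have [<-|ij] := eqVneq i j; first by rewrite diag0 mul0r.
have [->|Mij] := eqVneq (M i j) 0; first by rewrite mul0r.
have [->|lj] := eqVneq l j; first by rewrite diag0 mulr0.
by rewrite (offdiagonal_entry XM ij Mij lj) mulr0.
Qed.

End TorusStableMatrices.

(** * Diagonal normalization forces nilpotents to have square zero *)

Section Normalized.
Variables (K : closedFieldType) (A : falgType K).
Hypothesis hK : [pchar K] =i pred0.
Hypothesis hc : alg_commutative A.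

Lemma normalized_nilpotent_square_zero :
  normalized_by_diagonal (@unit_group K A) -> nilpotent_square_zero A.
Proof.
move=> [bs bbs hb] a [k ak].
pose n := size bs; pose b : n.-tuple A := in_tuple bs.
have bb : basis_of {:A} b by [].
pose rho (x : A) : 'M[K]_n := \matrix_(i, j) coord b i (x * b`_j).
have rho_lin c x y : rho (c *: x + y) = c *: rho x + rho y.
  by apply/matrixP => i j; rewrite !mxE mulrDl -scalerAl linearP.
have bE x : x = \sum_i coord b i x *: b`_i by apply: (coord_basis bb (memvf x)).
have rhoM x y : rho (x * y) = rho x *m rho y.
  apply/matrixP => i j; rewrite !mxE -mulrA {1}(bE (y * b`_j)) mulr_sumr linear_sum.
  by apply: eq_bigr => l _; rewrite -scalerAr linearZ !mxE mulrC.
have rho_inj x : rho x = 0 -> x = 0.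
  move=> r0; rewrite -[x]mulr1 (bE 1) mulr_sumr big1 // => j _.
  rewrite -scalerAr (bE (x * _)) big1 ?scaler0 // => i _.
  by have := congr1 (fun M : 'M_n => M i j) r0; rewrite !mxE => ->; rewrite scale0r.
have rhoX x q : rho (x ^+ q.+1) = rho x ^+ q.+1.
  by elim: q => [|q IH] //; rewrite exprS rhoM IH mulmxE -exprS.
have conj d x : (forall i, d i != 0) -> exists x', rho x' = diag_conj d (rho x).
  move=> d0.
  pose D := linfun (lincomb b \o (mulmxr (diag_mx (\row_i d i)) \o coord_row b)).
  have DE y i : coord b i (D y) = d i * coord b i y.
    have -> : coord b i (D y) = coord_row b (D y) 0 i by rewrite mxE.
    by rewrite lfunE /= lincombK // mul_mx_diag !mxE mulrC.
  have Db (j : 'I_n) : D b`_j = d j *: b`_j.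
    rewrite [LHS]bE (bigD1 j) //= DE coord_free ?(basis_free bb) // eqxx mulr1.
    rewrite big1 ?addr0 // => i ij.
    by rewrite DE coord_free ?(basis_free bb) // eq_sym (negPf ij) mulr0 scale0r.
  have dD : diagonal_wrt bs D.
    move=> v vb; exists (d (Ordinal (etrans (index_mem _ _) vb))) => //.
    by have := Db (Ordinal (etrans (index_mem _ _) vb)); rewrite /= nth_index.
  have D0 := diagonal_lker0 bbs dD.
  (* The hypothesis applies to units only; conjugation fixes scalars, so [x - c] is conjugated and
     [c] is added back. *)
  have [c c0 uu] := unit_shift hc x.
  have : unit_group A (amull (x - c%:A)) by exists (x - c%:A).
  move/(hb D dD) => [u' _ u'E].
  have Du y : D ((x - c%:A) * y) = u' * D y.
    have := congr1 (fun h : 'End(A) => h (D y)) u'E.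
    by rewrite !comp_lfunE lker0_lfunK // !lfunE.
  exists (u' + c%:A); apply/matrixP => i j; rewrite !mxE.
  apply: (mulIf (d0 j)).
  rewrite [RHS](_ : _ = d i * coord b i (x * b`_j)); last by field; apply: d0.
  rewrite -DE mulrC -[d j * _]linearZ /= scalerAr -Db; congr (coord b i _).
  rewrite -[in RHS](subrK c%:A x) [in RHS]mulrDl linearD /= Du mulrDl; congr (_ + _).
  by rewrite !mulr_algl linearZ.
have k0 : a ^+ k.+1 = 0 by rewrite exprS ak mulr0.
apply: rho_inj; rewrite rhoX expr2.
apply: (@torus_stable_nilpotent _ _ (fun M => exists x, M = rho x)) (_ : rho a ^+ k.+1 = 0).
- exact: hK.
- by move=> c _ _ [x ->] [y ->]; exists (c *: x + y).
- by move=> _ _ [x ->] [y ->]; rewrite -!rhoM hc.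
- by move=> d _ d0 [x ->]; have [x' x'E] := conj d x d0; exists x'.
- by exists a.
- by rewrite -rhoX k0; apply/matrixP => i j; rewrite !mxE mul0r linear0.
Qed.

End Normalized.

(** * The algebra of a prehomogeneous module *)

(** The product on [V] is constructed inside a proof, from a point of the open orbit; packaging its
    laws as a term lets the copy [alg_of] of [V] carry the algebra instances. *)
Record comm_mul (K : fieldType) (V : vectType K) := CommMul {
  cm_mul : V -> V -> V;
  cm_one : V;
  cm_A : associative cm_mul;
  cm_C : commutative cm_mul;
  cm_1 : left_id cm_one cm_mul;
  cm_D : left_distributive cm_mul +%R;
  cm_neq0 : cm_one != 0;
  cm_Z : forall a x y, a *: cm_mul x y = cm_mul (a *: x) y }.

Definition alg_of (K : fieldType) (V : vectType K) (S : comm_mul V) : Type := V.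

Section AlgOf.
Variables (K : fieldType) (V : vectType K) (S : comm_mul V).
HB.instance Definition _ := Vector.copy (alg_of S) V.
HB.instance Definition _ := GRing.Zmodule_isComNzRing.Build (alg_of S)
  (@cm_A _ _ S) (@cm_C _ _ S) (@cm_1 _ _ S) (@cm_D _ _ S) (@cm_neq0 _ _ S).
HB.instance Definition _ := GRing.Lmodule_isLalgebra.Build K (alg_of S) (@cm_Z _ _ S).

Fact alg_of_scaleAr (a : K) (x y : alg_of S) : a *: (x * y) = x * (a *: y).
Proof. by rewrite mulrC scalerAl mulrC. Qed.
HB.instance Definition _ := GRing.Lalgebra_isAlgebra.Build K (alg_of S) alg_of_scaleAr.
HB.instance Definition _ := Algebra_isFalgebra.Build K (alg_of S).

Definition to_alg (v : V) : alg_of S := v.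
Definition of_alg (v : alg_of S) : V := v.
Fact to_alg_is_linear : linear to_alg. Proof. by []. Qed.
Fact of_alg_is_linear : linear of_alg. Proof. by []. Qed.
HB.instance Definition _ :=
  GRing.isLinear.Build K V (alg_of S) *:%R to_alg to_alg_is_linear.
HB.instance Definition _ :=
  GRing.isLinear.Build K (alg_of S) V *:%R of_alg of_alg_is_linear.

Lemma alg_of_equivalent (H : 'End(V) -> Prop) :
  (forall h, H h <-> exists2 u, exists u', cm_mul S u u' = cm_one S
                                & forall x, h x = cm_mul S u x) ->
  equivalent H (@unit_group K (alg_of S)).
Proof.
move=> HP; apply: (@equivalentI _ _ _ _ _ (linfun to_alg) (linfun of_alg)).
- by move=> x; rewrite !lfunE.
- by move=> x; rewrite !lfunE.
- move=> h /HP[u [u' uu'] hu]; exists (u : alg_of S).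
    by apply/unitrP; exists (u' : alg_of S); rewrite mulrC.
  by apply/lfunP => x; rewrite !comp_lfunE !lfunE /= hu.
move=> h [u uu ->]; apply/HP; exists u.
  by exists (u^-1 : alg_of S); apply: (mulrV uu).
by move=> x; rewrite !comp_lfunE !lfunE.
Qed.
End AlgOf.

Section OpenOrbit.
Variables (K : closedFieldType) (N : nat) (G : 'M[K]_N -> Prop).
Hypothesis hK : [pchar K] =i pred0.
Hypothesis hG : lin_alg_group G.
Hypothesis hcomm : mx_commutative G.

Lemma group_unitmx g : G g -> g \in unitmx.
Proof. by case: hG => [[S hS] _ _ _] /hS[]. Qed.

Lemma group_one : G 1%:M. Proof. by case: hG. Qed.

Lemma group_mul g h : G g -> G h -> G (g *m h).
Proof. by case: hG => _ _ h1 _; apply: h1. Qed.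

Lemma group_inv g : G g -> G (invmx g).
Proof. by case: hG => _ _ _; apply. Qed.

Section Action.
Variable V : prehom_module G.
Local Notation act := (act V).

Lemma act_inv g v : G g -> act (invmx g) (act g v) = v.
Proof.
move=> Gg; rewrite -comp_lfunE -actM //; last exact: group_inv.
by rewrite mulVmx ?group_unitmx // act1 id_lfunE.
Qed.

Lemma act_comm g h v : G g -> G h -> act g (act h v) = act h (act g v).
Proof. by move=> Gg Gh; rewrite -!comp_lfunE -!actM // hcomm. Qed.

Lemma vect_eval_line (p : {mpoly K[\dim {:V}]}) (v w : V) :
  exists q : {poly K}, forall x, vect_eval p (v + x *: w) = q.[x].
Proof.
have [q qE] := fs_meval (poly_fun_subring K) p
  (fun i => poly_fun_line (coord (vbasis {:V}) i v) (coord (vbasis {:V}) i w)).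
exists q => x; rewrite -qE /vect_eval; apply: meval_eq => i.
by rewrite linearD linearZ.
Qed.

(** One of the equations of the complement is nonzero at [v0], and wherever it is nonzero the point
    lies in the orbit. *)
Lemma orbit_polynomial : exists (v0 : V) (p0 : {mpoly K[\dim {:V}]}),
  vect_eval p0 v0 != 0 /\
  forall w, vect_eval p0 w != 0 -> exists2 g, G g & w = act g v0.
Proof.
have [v0 [S hS]] := act_open_orbit V.
have /hS/not_all_ex_not[p0 Hp] : exists2 g, G g & v0 = act g v0.
  by exists 1%:M; [exact: group_one | rewrite act1 id_lfunE].
have [Sp0 p0v] := imply_to_and _ _ Hp.
exists v0, p0; split=> [|w wp]; first exact/eqP.
by apply/hS => H; move/eqP: wp; apply; apply: H.
Qed.

(** The functions are the coordinates of the orbit map. A relation among them vanishes wherever [p0]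
    does not, hence along every line through [v0], hence everywhere. *)
Lemma orbit_independent : exists f : 'I_(\dim {:V}) -> 'M[K]_N -> K,
  (forall i, regular_on G (f i)) /\ alg_independent_on G f.
Proof.
have [v0 [p0 [p0v p0P]]] := orbit_polynomial.
exists (fun i g => coord (vbasis {:V}) i (act g v0)); split=> [i|P PG].
  pose l : 'Hom(V, K^o) := linfun (coord (vbasis {:V}) i : V -> K^o).
  have [p [k pE]] := act_regular l v0; exists p, k => g Gg.
  by rewrite -pE // lfunE.
apply: mpoly_vanishing => // x.
pose v : V := \sum_i x i *: (vbasis {:V})`_i.
have vx i : coord (vbasis {:V}) i v = x i.
  by rewrite coord_sum_free // (basis_free (vbasisP _)).
rewrite -(meval_eq _ vx) -/(vect_eval P v).
have [q qE] := vect_eval_line P v0 (v - v0).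
have [q0 q0E] := vect_eval_line p0 v0 (v - v0).
have q00 : q0 != 0.
  apply: contraNneq p0v => q00; have := q0E 0.
  by rewrite scale0r addr0 q00 horner0 => ->.
have : q * q0 = 0.
  apply: poly_fun_infinite => // m; rewrite hornerM -qE -q0E.
  have [->|/p0P[g Gg ->]] := eqVneq (vect_eval p0 (v0 + m%:R *: (v - v0))) 0.
    by rewrite mulr0.
  by rewrite [vect_eval P _]PG ?mul0r.
move/eqP; rewrite mulf_eq0 (negPf q00) orbF => /eqP q0'.
by have := qE 1; rewrite scale1r addrC subrK q0' horner0.
Qed.

Definition centralizes (h : 'End(V)) := forall g v, G g -> h (act g v) = act g (h v).

(** Every vector is a multiple of some [act g v0 - v0], so an endomorphism commuting with [G] is
    determined by its value at [v0]. The product of [v] and [w] is [rho v w], where [rho v] combines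
    the operators [e i] so as to send [v0] to [v]. *)
Lemma prehom_algebra : (exists2 g, G g & g <> 1%:M) ->
  exists2 A : falgType K, alg_commutative A &
    equivalent (image_group V) (@unit_group K A).
Proof.
move=> [g1 Gg1 g1n].
have [v0 [p0 [p0v p0P]]] := orbit_polynomial.
have span v : exists2 a : K, a != 0 & exists2 g, G g & a *: v = act g v0 - v0.
  have [q qE] := vect_eval_line p0 v0 v.
  have q00 : q != 0.
    apply: contraNneq p0v => q00; have := qE 0.
    by rewrite scale0r addr0 q00 horner0 => ->.
  have /closed_nonrootP[a] : 'X * q != 0 by rewrite mulf_neq0 ?polyX_eq0.
  rewrite rootE hornerM hornerX mulf_eq0 negb_or -qE => /andP[a0 /p0P[g Gg E]].
  by exists a => //; exists g => //; rewrite -E addrC addKr.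
have uniq h h' : centralizes h -> centralizes h' -> h v0 = h' v0 -> h = h'.
  move=> hh hh' E; apply/lfunP => v; have [a a0 [g Gg av]] := span v.
  apply: (scalerI a0); rewrite -!linearZ /= av !linearB /= hh // hh' // E //.
pose b := vbasis {:V}.
have /fin_all_exists2[a a0 /fin_all_exists2[g Gg gE]] (i : 'I_(\dim {:V})) := span b`_i.
pose e i := (a i)^-1 *: (act (g i) - \1%VF).
have eE i x : e i x = (a i)^-1 *: (act (g i) x - x) by rewrite /e !lfun_simp.
pose rho v : 'End(V) := \sum_i coord b i v *: e i.
have rhoE v x : rho v x = \sum_i coord b i v *: e i x.
  by rewrite sum_lfunE; apply: eq_bigr => i _; rewrite scale_lfunE.
have e_comm h i x : centralizes h -> h (e i x) = e i (h x).
  by move=> ch; rewrite !eE [LHS]linearZ linearB /= ch.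
have rho_comm v h x : centralizes h -> h (rho v x) = rho v (h x).
  move=> ch; rewrite !rhoE linear_sum; apply: eq_bigr => i _.
  by rewrite [LHS]linearZ /= e_comm.
have act_cent h : G h -> centralizes (act h) by move=> Gh k x Gk; apply: act_comm.
have rho_cent v : centralizes (rho v).
  by move=> h x Gh; rewrite rho_comm //; apply: act_cent.
have rho0 v : rho v v0 = v.
  rewrite rhoE [RHS](coord_vbasis (memvf v)); apply: eq_bigr => i _.
  by congr (_ *: _); rewrite eE -gE scalerA mulVf // scale1r.
have rho_act h : G h -> rho (act h v0) = act h.
  by move=> Gh; apply: uniq; rewrite ?rho0 //; apply: act_cent.
have rho1 : rho v0 = \1%VF by have := rho_act _ group_one; rewrite act1 id_lfunE.
have mulA : associative (fun v w => rho v w).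
  move=> u v w; rewrite -[v in RHS]rho0 -comp_lfunE; congr (fun_of_lfun _ _).
  apply: uniq => //.
    by move=> k x Gk; rewrite !comp_lfunE !rho_cent.
  by rewrite comp_lfunE !rho0.
have mulC : commutative (fun v w => rho v w).
  by move=> v w; rewrite -{1}[w]rho0 rho_comm // rho0.
have mul1 : left_id v0 (fun v w => rho v w) by move=> v; rewrite rho1 id_lfunE.
have mulD : left_distributive (fun v w => rho v w) +%R.
  by move=> u v w; rewrite ![rho _ w]mulC linearD.
(* If [v0] were 0, then [V] would be 0, and effectiveness would make [g1] trivial. *)
have v0n : v0 != 0.
  apply/eqP => v00; case: g1n; apply: (act_effective (p := V)) => //.
  apply/lfunP => v; have [c c0 [k Gk]] := span v; rewrite v00 linear0 subr0 => /eqP.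
  by rewrite scaler_eq0 (negPf c0) => /eqP ->; rewrite !linear0.
have mulZ c u v : c *: rho u v = rho (c *: u) v.
  by rewrite [rho u v]mulC [rho _ v]mulC linearZ.
pose S := CommMul mulA mulC mul1 mulD v0n mulZ.
exists (alg_of S : falgType K); first by move=> x y; apply: mulrC.
apply: alg_of_equivalent => h; rewrite /=; split=> [[k Gk ->]|[u [u' uu'] hu]].
  exists (act k v0); last by move=> x; rewrite rho_act.
  by exists (act (invmx k) v0); rewrite rho_act // act_comm ?act_inv //; apply: group_inv.
(* Multiplication by [u] carries the line from [u'] to [v0] to the line from [v0] to [u]. A common
   parameter [c] puts a point of the first, [act k' v0], and its image [act k v0] in the orbit, so
   [u] is in the orbit. *)
have [q qE] := vect_eval_line p0 v0 (u - v0).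
have [q' q'E] := vect_eval_line p0 u' (v0 - u').
have : q * q' != 0.
  apply: mulf_neq0; apply: contraNneq p0v => q0.
    by have := qE 0; rewrite scale0r addr0 q0 horner0 => ->.
  by have := q'E 1; rewrite scale1r addrC subrK q0 horner0 => ->.
move/closed_nonrootP => [c]; rewrite rootE hornerM mulf_eq0 negb_or -qE -q'E.
case/andP => /p0P[k Gk kE] /p0P[k' Gk' k'E].
have uk : rho u (act k' v0) = act k v0.
  by rewrite -k'E -kE linearD linearZ linearB /= uu' rho0.
have uE : u = act (invmx k' *m k) v0.
  rewrite actM ?comp_lfunE //; last exact: group_inv.
  by rewrite -uk rho_cent // rho0 act_inv.
have GkI : G (invmx k' *m k) by apply: group_mul => //; apply: group_inv.
exists (invmx k' *m k) => //; apply/lfunP => x.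
by rewrite hu uE rho_act.
Qed.
End Action.
End OpenOrbit.

(** * Regular functions on the torus-vector group *)

Section TorusVector.
Variables (K : fieldType) (r s : nat).
Implicit Types (t : 'rV[K]_r) (x : 'rV[K]_s).

Definition tvmx t x : 'M[K]_(r + (1 + s)) :=
  block_mx (diag_mx t) 0 0 (block_mx 1%:M x 0 1%:M).

Definition torus_part (B : 'M[K]_(r + (1 + s))) : 'rV[K]_r :=
  \row_i B (lshift (1 + s) i) (lshift (1 + s) i).

Definition vector_part (B : 'M[K]_(r + (1 + s))) : 'rV[K]_s :=
  \row_j B (rshift r (lshift s ord0)) (rshift r (rshift 1 j)).

Lemma torus_part_tvmx t x : torus_part (tvmx t x) = t.
Proof. by apply/rowP => i; rewrite mxE block_mxEul mxE eqxx mulr1n. Qed.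

Lemma vector_part_tvmx t x : vector_part (tvmx t x) = x.
Proof. by apply/rowP => i; rewrite mxE block_mxEdr block_mxEur. Qed.

Lemma tvmx_mul t t' x x' :
  tvmx t x *m tvmx t' x' = tvmx (\row_i (t 0 i * t' 0 i)) (x + x').
Proof.
rewrite /tvmx !mulmx_block !(mul0mx, mulmx0, mul1mx, mulmx1, addr0, add0r).
rewrite [x' + x]addrC; congr block_mx.
by rewrite mulmx_diag; congr diag_mx; apply/rowP => i; rewrite !mxE.
Qed.

Lemma tvmx1 : tvmx (const_mx 1) 0 = 1%:M.
Proof. by rewrite /tvmx diag_const_mx -!scalar_mx_block. Qed.

Lemma det_tvmx t x : \det (tvmx t x) = \prod_i t 0 i.
Proof. by rewrite /tvmx det_ublock det_diag det_ublock !det1 !mulr1. Qed.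

Lemma torus_vectorP (B : 'M[K]_(r + (1 + s))) : torus_vector_group B <->
  exists t x, (forall i, t 0 i != 0) /\ B = tvmx t x.
Proof. by []. Qed.

Lemma tvmx_entry_fun (T : Type) (C : (T -> K) -> Prop) (t : T -> 'rV[K]_r)
    (x : T -> 'rV[K]_s) : fun_subring C ->
  (forall i, C (fun a => t a 0 i)) -> (forall j, C (fun a => x a 0 j)) ->
  forall i j, C (fun a => tvmx (t a) (x a) i j).
Proof.
move=> hC Ct Cx i j; have C0 : C (fun=> 0) by apply: fs_const.
case: (split_ordP i) => i' ->; case: (split_ordP j) => j' ->.
- case: (eqVneq i' j') => [->|ij].
    by apply: (fs_ext hC) (Ct j') => a; rewrite block_mxEul mxE eqxx mulr1n.
  by apply: (fs_ext hC) C0 => a; rewrite block_mxEul mxE (negPf ij) mulr0n.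
- by apply: (fs_ext hC) C0 => a; rewrite block_mxEur mxE.
- by apply: (fs_ext hC) C0 => a; rewrite block_mxEdl mxE.
case: (split_ordP i') => i'' ->; case: (split_ordP j') => j'' ->.
- apply: (fs_ext hC) (fs_const hC ((i'' == j'')%:R)) => a.
  by rewrite block_mxEdr block_mxEul mxE.
- by apply: (fs_ext hC) (Cx j'') => a; rewrite block_mxEdr block_mxEur (ord1 i'').
- by apply: (fs_ext hC) C0 => a; rewrite block_mxEdr block_mxEdl mxE.
- apply: (fs_ext hC) (fs_const hC ((i'' == j'')%:R)) => a.
  by rewrite block_mxEdr block_mxEdr mxE.
Qed.

End TorusVector.

Section RationalFunctions.
Variables (K : fieldType) (d : nat) (T : Type) (co : T -> 'I_d -> K) (X : T -> Prop).

Definition rational_fun (f : T -> K) := exists P Q : {mpoly K[d]},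
  forall v, X v -> Q.@[co v] != 0 /\ f v = P.@[co v] / Q.@[co v].

Lemma rational_fun_subring : fun_subring rational_fun.
Proof.
split.
- by move=> c; exists c%:MP, 1 => v _; rewrite mevalC meval1 oner_neq0 divr1.
- move=> f g [P [Q fE]] [P' [Q' gE]]; exists (P * Q' + P' * Q), (Q * Q') => v Xv.
  have [Q0 ->] := fE v Xv; have [Q'0 ->] := gE v Xv.
  by rewrite mevalD !mevalM mulf_neq0 // addf_div.
- move=> f g [P [Q fE]] [P' [Q' gE]]; exists (P * P'), (Q * Q') => v Xv.
  have [Q0 ->] := fE v Xv; have [Q'0 ->] := gE v Xv.
  by rewrite !mevalM mulf_neq0 // mulf_div.
- by move=> f g fg [P [Q fE]]; exists P, Q => v /fE; rewrite fg.
Qed.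

Lemma rational_fun_inv f : rational_fun f -> (forall v, X v -> f v != 0) ->
  rational_fun (fun v => (f v)^-1).
Proof.
move=> [P [Q fE]] f0; exists Q, P => v Xv.
have [Q0 E] := fE v Xv; have := f0 v Xv; rewrite E invf_div; split=> //.
by apply: contraNneq (f0 v Xv); rewrite E => ->; rewrite mul0r.
Qed.

Lemma rational_fun_coord i : rational_fun (fun v => co v i).
Proof. by exists 'X_i, 1 => v _; rewrite mevalXU meval1 oner_neq0 divr1. Qed.

Lemma rational_fun_eq f g : (forall v, X v -> f v = g v) -> rational_fun f ->
  rational_fun g.
Proof. by move=> fg [P [Q fE]]; exists P, Q => v Xv; rewrite -fg //; apply: fE. Qed.

Lemma rational_fun_regular N (Y : 'M[K]_N -> Prop) (M : T -> 'M[K]_N) F :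
  (forall v, X v -> Y (M v)) -> (forall v, X v -> M v \in unitmx) ->
  (forall i j, rational_fun (fun v => M v i j)) ->
  regular_on Y F -> rational_fun (fun v => F (M v)).
Proof.
move=> XY Mu Mr [p [k FE]].
have h := rational_fun_subring.
apply: (@rational_fun_eq (fun v => mx_eval p (M v) * (\det (M v) ^+ k)^-1)).
  by move=> v /XY/FE ->.
apply: (fs_mul h); first exact: fs_mx_eval.
apply: rational_fun_inv => [|v Xv]; first by apply: (fs_exp h); apply: fs_det.
by have := Mu v Xv; rewrite unitmxE unitfE => ?; apply: expf_neq0.
Qed.

Lemma rational_fun_dependent m (f : 'I_m -> T -> K) : (d < m)%N ->
  (forall i, rational_fun (f i)) ->
  exists2 F : {mpoly K[m]}, F != 0 & forall v, X v -> F.@[fun i => f i v] = 0.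
Proof.
move=> dm /fin_all_exists[P /fin_all_exists[Q fE]].
pose R := \prod_i Q i; pose P' i := P i * \prod_(j | j != i) Q j.
have [F F0 FE] := rational_dependent P' R dm; exists F => // v Xv.
have R0 : R.@[co v] != 0.
  by rewrite rmorph_prod /=; apply/prodf_neq0 => i _; have [] := fE i v Xv.
rewrite -[RHS](FE _ R0); apply: meval_eq => i.
have [Q0 ->] := fE i v Xv.
have RE : R = Q i * \prod_(j | j != i) Q j by rewrite /R (bigD1 i).
move: R0; rewrite RE /P' !mevalM mulf_eq0 negb_or => /andP[_ S0].
by rewrite -mulf_div divff // mulr1.
Qed.

End RationalFunctions.

(** * The dimension bound and the unipotent lines of [G] *)

Section Rank.
Variables (K : closedFieldType) (N : nat) (G : 'M[K]_N -> Prop) (r s : nat).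
Variables (phi : 'M[K]_N -> 'M[K]_(r + (1 + s))) (psi : 'M[K]_(r + (1 + s)) -> 'M[K]_N).
Hypothesis hK : [pchar K] =i pred0.
Hypothesis hG : lin_alg_group G.
Hypothesis hphi : group_morphism G (@torus_vector_group K r s) phi.
Hypothesis hpsi : group_morphism (@torus_vector_group K r s) G psi.
Hypothesis phiK : forall g, G g -> psi (phi g) = g.
Hypothesis psiK : forall B, torus_vector_group B -> phi (psi B) = B.

Lemma tvmx_group (t : 'rV[K]_r) (x : 'rV[K]_s) :
  (forall i, t 0 i != 0) -> torus_vector_group (tvmx t x).
Proof. by exists t, x. Qed.

Lemma tvmx_one_group (x : 'rV[K]_s) : torus_vector_group (tvmx (const_mx (m := 1) (n := r) 1) x).
Proof. by apply: tvmx_group => i; rewrite mxE oner_neq0. Qed.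

Lemma psi_group B : torus_vector_group B -> G (psi B).
Proof. by case: hpsi => h _ _; apply: h. Qed.

Lemma phi_group g : G g -> torus_vector_group (phi g).
Proof. by case: hphi => h _ _; apply: h. Qed.

Lemma psiM B B' : torus_vector_group B -> torus_vector_group B' ->
  psi (B *m B') = psi B *m psi B'.
Proof. by case: hpsi => _ h _; apply: h. Qed.

Lemma phiM g h : G g -> G h -> phi (g *m h) = phi g *m phi h.
Proof. by case: hphi => _ H _; apply: H. Qed.

Lemma psi1 : psi 1%:M = 1%:M.
Proof.
have T1 : torus_vector_group (1%:M : 'M[K]_(r + (1 + s))).
  by rewrite -tvmx1; apply: tvmx_one_group.
have pu := group_unitmx hG (psi_group T1).
have := congr1 (mulmx (invmx (psi 1%:M))) (psiM T1 T1).
by rewrite mulmx1 mulVmx // mulKmx // => <-.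
Qed.

Lemma phi1 : phi 1%:M = 1%:M.
Proof.
rewrite -{1}psi1 psiK // -tvmx1; apply: tvmx_one_group.
Qed.

(** Through [psi], regular functions on [G] become rational functions of [r + s] variables; a
    relation found there holds on all of [G], since each [g] is [psi (phi g)]. *)
Lemma dimension_le n (f : 'I_n -> 'M[K]_N -> K) :
  (forall i, regular_on G (f i)) -> alg_independent_on G f -> (n <= r + s)%N.
Proof.
move=> fr fi; rewrite leqNgt; apply/negP => lt_n.
pose B (v : 'rV[K]_(r + s)) := tvmx (\row_i v 0 (lshift s i)) (\row_j v 0 (rshift r j)).
pose X (v : 'rV[K]_(r + s)) := forall i, v 0 (lshift s i) != 0.
pose co (v : 'rV[K]_(r + s)) l := v 0 l.
have XB v : X v -> torus_vector_group (B v).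
  by move=> Xv; apply: tvmx_group => i; rewrite mxE.
have h := rational_fun_subring co X.
have Br i j : rational_fun co X (fun v => B v i j).
  apply: (tvmx_entry_fun h) => l.
    by apply: (fs_ext h) (rational_fun_coord co X (lshift s l)) => v; rewrite mxE.
  by apply: (fs_ext h) (rational_fun_coord co X (rshift r l)) => v; rewrite mxE.
have psir i j : rational_fun co X (fun v => psi (B v) i j).
  have [_ _ psireg] := hpsi.
  apply: (rational_fun_regular (F := fun A => psi A i j) XB _ Br (psireg i j)) => v Xv.
  rewrite unitmxE unitfE det_tvmx; apply/prodf_neq0 => l _; rewrite mxE; exact: Xv.
have fpr i : rational_fun co X (fun v => f i (psi (B v))).
  apply: (rational_fun_regular (Y := G) (M := fun v => psi (B v))) psir (fr i).
    by move=> v /XB/psi_group.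
  by move=> v /XB/psi_group/(group_unitmx hG).
have [F F0 FE] := rational_fun_dependent lt_n fpr.
case/eqP: F0; apply: fi => g Gg.
have [t [x [t0 pE]]] := phi_group Gg.
rewrite -[RHS](FE (row_mx t x)); last by move=> i; rewrite row_mxEl.
apply: meval_eq => i; rewrite -{1}(phiK Gg) pE; congr (f i (psi _)).
rewrite /B /tvmx; congr (block_mx (diag_mx _) _ _ (block_mx _ _ _ _)).
  by apply/rowP => l; rewrite mxE row_mxEl.
by apply/rowP => l; rewrite mxE row_mxEr.
Qed.

Lemma poly_fun_opp (f : K -> K) : poly_fun f -> poly_fun (fun c => f (- c)).
Proof.
by move=> [p pE]; exists (p \Po (- 'X)) => c; rewrite horner_comp !hornerE pE.
Qed.

(** Polynomial and not merely rational: along the line, the inverse of the determinant at [c] is the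
    determinant at [- c], again a polynomial. *)
Lemma regular_unipotent_line (F : 'M[K]_N -> K) (x : 'rV[K]_s) :
  regular_on G F -> poly_fun (fun c => F (psi (tvmx (const_mx 1) (c *: x)))).
Proof.
move=> [p [k FE]]; have h := poly_fun_subring K.
pose y c := psi (tvmx (const_mx 1) (c *: x)).
have yG c : G (y c) by apply/psi_group/tvmx_one_group.
have yr i j : poly_fun (fun c => y c i j).
  have [_ _ psireg] := hpsi; have [q [l qE]] := psireg i j.
  apply: (fs_ext h (f := fun c => mx_eval q (tvmx (const_mx 1) (c *: x)))).
    move=> c; rewrite /y qE; last exact: tvmx_one_group.
    by rewrite det_tvmx big1 ?expr1n ?divr1 // => m _; rewrite mxE.
  apply: (fs_mx_eval h); apply: (tvmx_entry_fun h) => m.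
    by apply: (fs_ext h) (fs_const h 1) => c; rewrite mxE.
  apply: (fs_ext h) (poly_fun_line 0 (x 0 m)) => c.
  by rewrite mxE add0r.
have dV c : \det (y c) * \det (y (- c)) = 1.
  rewrite -det_mulmx -psiM ?tvmx_mul; try exact: tvmx_one_group.
  rewrite scaleNr subrr (_ : \row_i _ = const_mx 1) ?tvmx1 ?psi1 ?det1 //.
  by apply/rowP => i; rewrite !mxE mulr1.
apply: (fs_ext h (f := fun c => mx_eval p (y c) * \det (y (- c)) ^+ k)).
  move=> c; have dk0 : \det (y c) ^+ k != 0.
    by rewrite expf_neq0 //; have := group_unitmx hG (yG c); rewrite unitmxE unitfE.
  rewrite [RHS](FE _ (yG c)); congr (_ * _); apply: (mulfI dk0).
  by rewrite -exprMn dV expr1n mulfV.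
apply: (fs_mul h); first exact: (fs_mx_eval h).
by apply: (fs_exp h); apply: (poly_fun_opp (f := fun c => \det (y c))); apply: (fs_det h).
Qed.

End Rank.

(** * Unit groups and the modules of the models *)

(** The identity [f a * f (- a) = 1] makes the polynomial a unit of [{poly K}], hence constant. *)
Lemma poly_fun_mult_const (K : fieldType) (hK : [pchar K] =i pred0) (f : K -> K) :
  poly_fun f -> f 0 = 1 -> (forall a, f a * f (- a) = 1) -> forall a, f a = 1.
Proof.
move=> [p pE] f0 fN a.
have E : p * (p \Po (- 'X)) = 1.
  apply/eqP; rewrite -subr_eq0; apply/eqP/(poly_fun_infinite hK) => m.
  by rewrite !hornerE horner_comp !hornerE -!pE fN subrr.
have : p \is a GRing.unit by apply/unitrP; exists (p \Po (- 'X)); rewrite mulrC.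
rewrite poly_unitE => /andP[/eqP p1 _].
have := pE a; have := pE 0.
by rewrite (size1_polyC (p := p)) ?p1 // !hornerC f0 => <-.
Qed.

(** Both sides are polynomials that agree on the natural numbers, an infinite set in characteristic
    zero. *)
Lemma poly_fun_additive (K : fieldType) (hK : [pchar K] =i pred0) (f : K -> K) :
  poly_fun f -> (forall a b, f (a + b) = f a + f b) -> forall a, f a = a * f 1.
Proof.
move=> [p pE] fD a; have f0 : f 0 = 0.
  by apply: (addrI (f 0)); rewrite -fD !addr0.
have fn (m : nat) : f m%:R = m%:R * f 1.
  by elim: m => [|m IH]; rewrite ?mul0r // -natr1 fD IH mulrDl mul1r.
suff : p - (f 1)%:P * 'X = 0.
  by move/eqP; rewrite subr_eq0 => /eqP pE'; rewrite pE pE' !hornerE mulrC.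
apply: (poly_fun_infinite hK) => m.
by rewrite !hornerE -pE fn mulrC subrr.
Qed.

Definition row_entry (K : fieldType) n (l : 'I_n) (v : 'rV[K]_n) : K^o := v 0 l.
Fact row_entry_is_linear (K : fieldType) n (l : 'I_n) : linear (@row_entry K n l).
Proof. by move=> a v w; rewrite /row_entry !mxE. Qed.
HB.instance Definition _ (K : fieldType) n (l : 'I_n) :=
  GRing.isLinear.Build K 'rV[K]_n K^o *:%R (@row_entry K n l) (row_entry_is_linear l).

Section UnitGroups.
Variables (K : closedFieldType) (N : nat) (G : 'M[K]_N -> Prop) (r s : nat).
Variables (phi : 'M[K]_N -> 'M[K]_(r + (1 + s))) (psi : 'M[K]_(r + (1 + s)) -> 'M[K]_N).
Hypothesis hK : [pchar K] =i pred0.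
Hypothesis hG : lin_alg_group G.
Hypothesis hphi : group_morphism G (@torus_vector_group K r s) phi.
Hypothesis hpsi : group_morphism (@torus_vector_group K r s) G psi.
Hypothesis phiK : forall g, G g -> psi (phi g) = g.
Hypothesis psiK : forall B, torus_vector_group B -> phi (psi B) = B.

(** A group isomorphism from [G] to the units of [A] with regular coordinates, through which [r] and
    [s] are compared with invariants of [A]. *)
Record unit_param (A : falgType K) (U : 'M[K]_N -> A) : Prop := UnitParam {
  up_unit : forall g, G g -> U g \is a GRing.unit;
  up_mul : forall g h, G g -> G h -> U (g *m h) = U g * U h;
  up_inj : forall g, G g -> U g = 1 -> g = 1%:M;
  up_surj : forall u, u \is a GRing.unit -> exists2 g, G g & u = U g;
  up_regular : forall l : 'Hom(A, K^o), regular_on G (fun g => l (U g)) }.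

Lemma equivalent_unit_param (A : falgType K) (V : prehom_module G) :
  equivalent (image_group V) (@unit_group K A) -> exists U : 'M[K]_N -> A, unit_param U.
Proof.
move/equivalentE => [f [g [fK gK HH' H'H]]].
pose U k := f (act V k (g 1)); exists U.
have key k : G k -> U k \is a GRing.unit /\ forall x, f (act V k (g x)) = U k * x.
  move=> Gk; have [|u uu uE] := HH' (act V k); first by exists k.
  have E x : f (act V k (g x)) = u * x.
    by have := congr1 (fun h : 'End(A) => h x) uE; rewrite !comp_lfunE lfunE.
  by rewrite /U E mulr1.
split=> [k /key[]//|k h Gk Gh|k Gk Uk|u uu|l].
- have [_ <-] := key _ Gk.
  by rewrite /U actM // comp_lfunE fK.
- apply: (act_effective (p := V)) => //; apply/lfunP => x; rewrite id_lfunE.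
  have [_ E] := key _ Gk; have := E (f x); rewrite Uk mul1r fK.
  by apply: (can_inj fK).
- have [|k Gk kE] := H'H (amull u); first by exists u.
  exists k => //; rewrite /U -kE !comp_lfunE gK lfunE /= gK mulr1 //.
have [p [k pE]] := act_regular (p := V) (l \o f)%VF (g 1).
by exists p, k => h Gh; rewrite -pE // comp_lfunE.
Qed.

Section Param.
Variables (A : falgType K) (U : 'M[K]_N -> A).
Hypothesis hU : unit_param U.

Lemma up_one : U 1%:M = 1.
Proof.
have G1 := group_one hG; have uu := up_unit hU G1.
by apply: (mulrI uu); rewrite mulr1 -(up_mul hU) // mulmx1.
Qed.

Lemma up_injective g h : G g -> G h -> U g = U h -> g = h.
Proof.
move=> Gg Gh E; have GhI := group_inv hG Gh.
have hu := group_unitmx hG Gh.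
have : invmx h *m g = 1%:M.
  apply: (up_inj hU); first exact: group_mul.
  by rewrite (up_mul hU) // E -(up_mul hU) // mulVmx // up_one.
by move/(congr1 (mulmx h)); rewrite mulKVmx // mulmx1.
Qed.

Lemma up_psi_inj B B' : torus_vector_group B -> torus_vector_group B' ->
  U (psi B) = U (psi B') -> B = B'.
Proof.
move=> TB TB' /(up_injective (psi_group hpsi TB) (psi_group hpsi TB')) E.
by rewrite -(psiK TB) E psiK.
Qed.

(** The vector part has no 2-torsion in characteristic zero, so involutions come from the signs in
    the torus. *)
Lemma up_involutions : involutions_indexed A r.
Proof.
pose B (b : {ffun 'I_r -> bool}) : 'M[K]_(r + (1 + s)) := tvmx (\row_i (-1) ^+ b i) 0.
have TB b : torus_vector_group (B b).
  by apply: tvmx_group => i; rewrite mxE signr_eq0.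
have BB b : B b *m B b = 1%:M.
  rewrite tvmx_mul addr0 -tvmx1; congr tvmx.
  by apply/rowP => i; rewrite !mxE -expr2 sqrr_sign.
have two : (2%:R : K) != 0 by have /pcharf0P -> := hK.
have sgn (b c : bool) : (-1) ^+ b = (-1) ^+ c :> K -> b = c.
  have H : (1 : K) <> -1 by move/eqP; rewrite -subr_eq0 opprK (negPf two).
  by case: b c => [] [] //; rewrite expr0 expr1 => E; case: H.
exists (fun b => U (psi (B b))) => [b c /up_psi_inj|u].
  move=> /(_ (TB b) (TB c))/(congr1 (@torus_part K r s)); rewrite !torus_part_tvmx => E.
  by apply/ffunP => i; apply: sgn; have := congr1 (fun t : 'rV_r => t 0 i) E; rewrite !mxE.
split=> [uu|[b ->]]; last first.
  have Gp := psi_group hpsi (TB b).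
  by rewrite -(up_mul hU) // -(psiM hpsi) // BB (psi1 hG hpsi) up_one.
have [g Gg uE] : exists2 g, G g & u = U g.
  by apply: (up_surj hU); apply/unitrP; exists u.
have gg : g *m g = 1%:M.
  by apply: (up_inj hU); [exact: group_mul | rewrite (up_mul hU) // -uE].
have [t [x [t0 gE]]] := proj1 (torus_vectorP _) (phi_group hphi Gg).
have : tvmx t x *m tvmx t x = tvmx (const_mx 1) 0.
  by rewrite tvmx1 -gE -(phiM hphi) // gg (phi1 hG hpsi psiK).
rewrite tvmx_mul => E.
have x0 : x = 0.
  have := congr1 (@vector_part K r s) E; rewrite !vector_part_tvmx => /eqP.
  by rewrite -mulr2n -scaler_nat scaler_eq0 (negPf two) => /eqP.
have /fin_all_exists[b bE] i : exists b : bool, t 0 i = (-1) ^+ b.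
  have := congr1 (fun B => torus_part B 0 i) E; rewrite /= !torus_part_tvmx !mxE.
  move/eqP; rewrite -expr2 sqrf_eq1 => /orP[]/eqP ->.
    by exists false.
  by exists true.
exists [ffun i => b i]; rewrite uE -{1}(phiK Gg) gE x0; congr (U (psi (tvmx _ _))).
by apply/rowP => i; rewrite mxE ffunE bE.
Qed.

(** On the vector part of [G], the idempotent coordinates of [W] are multiplicative polynomials
    along lines, hence 1; the remaining coordinates are then additive, hence linear. Injectivity of
    [W] leaves no room for [s' < s]. *)
Lemma up_vector_dim k s' (c : 'I_s' -> 'I_k) : model_iso A c -> (s <= s')%N.
Proof.
move=> [f [g [fK gK f1 fM]]].
have gM a b : g (a * b) = mulc c (g a) (g b) by apply: (can_inj fK); rewrite fM !gK.
have g1 : g 1 = onec K k s' by rewrite -f1 fK.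
pose W (x : 'rV[K]_s) := g (U (psi (tvmx (const_mx 1) x))).
have T1 (x : 'rV[K]_s) := tvmx_one_group r x.
have WD x y : W (x + y) = mulc c (W x) (W y).
  rewrite /W -gM -(up_mul hU); try exact: (psi_group hpsi (T1 _)).
  rewrite -(psiM hpsi) // tvmx_mul; congr (g (U (psi (tvmx _ _)))).
  by apply/rowP => i; rewrite !mxE mulr1.
have W0 : W 0 = onec K k s' by rewrite /W tvmx1 (psi1 hG hpsi) up_one g1.
have Wpoly x l : poly_fun (fun a => W (a *: x) 0 l).
  have := regular_unipotent_line hG hpsi x (up_regular hU (linfun (row_entry l) \o g)%VF).
  by apply: (fs_ext (poly_fun_subring K)) => a; rewrite comp_lfunE lfunE.
have Wl x a i : W (a *: x) 0 (lshift s' i) = 1.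
  apply: (poly_fun_mult_const hK (f := fun a => W (a *: x) 0 (lshift s' i))) => //.
    by rewrite scale0r W0 onecEl.
  by move=> b; rewrite -(mulcEl c) -WD scaleNr subrr W0 onecEl.
have Wl1 x i : W x 0 (lshift s' i) = 1 by rewrite -[x]scale1r Wl.
have WrD x y j : W (x + y) 0 (rshift k j) = W x 0 (rshift k j) + W y 0 (rshift k j).
  by rewrite WD mulcEr !Wl1 mul1r mulr1 addrC.
have WrZ x a j : W (a *: x) 0 (rshift k j) = a * W x 0 (rshift k j).
  rewrite -[in RHS](scale1r x).
  apply: (poly_fun_additive hK (f := fun a => W (a *: x) 0 (rshift k j))) => //.
  by move=> b d; rewrite scalerDl WrD.
rewrite leqNgt; apply/negP => lt_s.
pose M := \matrix_(i < s, j < s') W (delta_mx 0 i) 0 (rshift k j).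
have /rowV0Pn[x /sub_kermxP xM x0] : kermx M != 0.
  rewrite -mxrank_eq0 mxrank_ker subn_eq0 -ltnNge.
  by apply: leq_ltn_trans lt_s; apply: rank_leq_col.
have Wr0 j : W 0 0 (rshift k j) = 0 by rewrite W0 onecEr.
have Wx : W x = W 0.
  apply: eq_rV_split => j; first by rewrite !Wl1.
  rewrite Wr0; have := congr1 (fun v : 'rV_s' => v 0 j) xM; rewrite !mxE => <-.
  rewrite {1}[x]row_sum_delta; elim/big_rec2: _ => [//|i y1 y2 _ IH].
  by rewrite WrD WrZ IH mxE.
case/eqP: x0; have := can_inj gK Wx => /(up_psi_inj (T1 _) (T1 _)).
by move/(congr1 (@vector_part K r s)); rewrite !vector_part_tvmx.
Qed.

End Param.

Section ModelModule.
Variable c : 'I_s -> 'I_r.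

(** The unit [t (1 + x)] of the model; the factor of [t] at [c j] makes the map multiplicative. *)
Definition model_point (B : 'M[K]_(r + (1 + s))) : 'rV[K]_(r + s) :=
  row_mx (torus_part B)
    (\row_j (torus_part B 0 (c j) * vector_part B 0 j)).

Lemma model_pointEl t x i : model_point (tvmx t x) 0 (lshift s i) = t 0 i.
Proof. by rewrite row_mxEl torus_part_tvmx. Qed.

Lemma model_pointEr t x j :
  model_point (tvmx t x) 0 (rshift r j) = t 0 (c j) * x 0 j.
Proof. by rewrite row_mxEr mxE torus_part_tvmx vector_part_tvmx. Qed.

Lemma model_pointM B B' : torus_vector_group B -> torus_vector_group B' ->
  model_point (B *m B') = mulc c (model_point B) (model_point B').
Proof.
move=> /torus_vectorP[t [x [_ ->]]] /torus_vectorP[t' [x' [_ ->]]].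
rewrite tvmx_mul.
apply: eq_rV_split => i.
  by rewrite mulcEl !model_pointEl mxE.
by rewrite mulcEr !model_pointEl !model_pointEr !mxE; ring.
Qed.

Lemma model_point1 : model_point 1%:M = onec K r s.
Proof.
rewrite -tvmx1; apply: eq_rV_split => i.
  by rewrite model_pointEl mxE onecEl.
by rewrite model_pointEr onecEr [X in _ * X]mxE mulr0.
Qed.

Lemma model_point_cunit B : torus_vector_group B -> cunit (model_point B).
Proof. by move=> /torus_vectorP[t [x [t0 ->]]] i; rewrite model_pointEl. Qed.

Lemma model_point_surj v : cunit v ->
  exists2 g, G g & v = model_point (phi g).
Proof.
move=> vu; pose B := tvmx (\row_i v 0 (lshift s i))
  (\row_j (v 0 (rshift r j) / v 0 (lshift s (c j)))).
have TB : torus_vector_group B by apply: tvmx_group => i; rewrite mxE.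
exists (psi B); first exact: (psi_group hpsi).
rewrite psiK //; apply: eq_rV_split => i.
  by rewrite model_pointEl mxE.
by rewrite model_pointEr !mxE mulrC divfK.
Qed.

Lemma model_point_inj g : G g -> model_point (phi g) = onec K r s -> g = 1%:M.
Proof.
move=> Gg; have [t [x [t0 gE]]] := proj1 (torus_vectorP _) (phi_group hphi Gg).
rewrite -{2}(phiK Gg) gE => E.
have tE i : t 0 i = 1.
  by rewrite -(onecEl K s i) -E model_pointEl.
rewrite (_ : t = const_mx 1); last by apply/rowP => i; rewrite tE mxE.
rewrite (_ : x = 0) ?tvmx1 ?(psi1 hG hpsi) //.
apply/rowP => j; rewrite mxE -(onecEr K r j) -E model_pointEr tE mul1r //.
Qed.

Lemma model_point_regular l : regular_on G (fun g => model_point (phi g) 0 l).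
Proof.
have h := regular_on_subring (group_unitmx hG).
have [_ _ phir] := hphi.
case: (split_ordP l) => i ->.
  by apply: (fs_ext h) (phir _ _) => g; rewrite row_mxEl mxE.
apply: (fs_ext h) (fs_mul h (phir _ _) (phir _ _)) => g.
by rewrite row_mxEr !mxE.
Qed.

Lemma coord_mpoly_fun (V : vectType K) (l : 'Hom(V, K^o)) :
  mpoly_fun (fun v i => coord (vbasis {:V}) i v) (l : V -> K).
Proof.
have h := mpoly_fun_subring (fun (v : V) i => coord (vbasis {:V}) i v).
apply: (fs_ext h (f := fun v => \sum_i coord (vbasis {:V}) i v * l (vbasis {:V})`_i)).
  move=> v; rewrite [v in RHS](coord_vbasis (memvf v)) linear_sum.
  by apply: eq_bigr => i _; rewrite linearZ.
apply: (fs_sum h) => i; apply: (fs_mul h); last exact: fs_const.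
exact: mpoly_fun_coord.
Qed.

Lemma model_module : exists2 V : prehom_module G, \dim {:V} = (r + s)%N &
  equivalent (image_group V) (model_group (K := K) c).
Proof.
pose act g : 'End('rV[K]_(r + s)) := linfun (mulc c (model_point (phi g))).
have actE g v : act g v = mulc c (model_point (phi g)) v by rewrite lfunE.
have act1 : act 1%:M = \1%VF.
  by apply/lfunP => v; rewrite actE (phi1 hG hpsi psiK) model_point1 mul1c id_lfunE.
have actM g h : G g -> G h -> act (g *m h) = (act g \o act h)%VF.
  move=> Gg Gh; apply/lfunP => v; rewrite comp_lfunE !actE (phiM hphi) //.
  by rewrite model_pointM ?mulcA //; apply: (phi_group hphi).
have hr := regular_on_subring (group_unitmx hG).
have areg (l : 'Hom('rV[K]_(r + s), K^o)) v : regular_on G (fun g => l (act g v)).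
  apply: (fs_ext hr (f := fun g => \sum_i act g v 0 i * l (delta_mx 0 i))).
    move=> g; rewrite [act g v in RHS]row_sum_delta linear_sum.
    by apply: eq_bigr => i _; rewrite linearZ.
  apply: (fs_sum hr) => i; apply: (fs_mul hr); last exact: fs_const.
  case: (split_ordP i) => j ->.
    apply: (fs_ext hr) (fs_mul hr (model_point_regular (lshift s j))
      (fs_const hr (v 0 (lshift s j)))) => g.
    by rewrite actE mulcEl.
  apply: (fs_ext hr) (fs_add hr
    (fs_mul hr (model_point_regular (lshift s (c j))) (fs_const hr (v 0 (rshift r j))))
    (fs_mul hr (model_point_regular (rshift r j)) (fs_const hr (v 0 (lshift s (c j)))))) => g.
  by rewrite actE mulcEr.
have aeff g : G g -> act g = \1%VF -> g = 1%:M.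
  move=> Gg /(congr1 (fun h : 'End(_) => h (onec K r s))).
  by rewrite actE mulcC mul1c id_lfunE; apply: model_point_inj.
have aopen : exists v : 'rV[K]_(r + s),
    zariski_open (fun w => exists2 g, G g & w = act g v).
  exists (onec K r s).
  have h := mpoly_fun_subring (fun (v : 'rV[K]_(r + s)) i => coord (vbasis fullv) i v).
  have [p pE] : mpoly_fun (fun (v : 'rV[K]_(r + s)) i => coord (vbasis fullv) i v)
      (fun v => \prod_(i < r) v 0 (lshift s i)).
    apply: (fs_prod h) => i.
    apply: (fs_ext h) (coord_mpoly_fun (linfun (row_entry (lshift s i)))) => v.
    by rewrite lfunE.
  (* The orbit of the unit element is the set of units, the complement of the hypersurface where the
     product of the idempotent coordinates vanishes. *)
  exists (fun q => q = p) => w; split=> [[g Gg ->] /(_ p erefl) | nw].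
    rewrite actE mulcC mul1c /vect_eval -pE => /eqP.
    apply/negP/prodf_neq0 => i _; exact: (model_point_cunit (phi_group hphi Gg)).
  have wu : cunit w.
    move=> i; apply/eqP => wi; apply: nw => _ ->; rewrite /vect_eval -pE.
    by rewrite (bigD1 i) //= wi mul0r.
  have [g Gg wE] := model_point_surj wu; exists g => //.
  by rewrite actE mulcC mul1c.
exists (PrehomModule act1 actM areg aeff aopen).
  by rewrite dimvf dim_matrix mul1r.
apply: (@equivalentI _ _ _ _ _ \1%VF \1%VF) => [v|v|h|h]; rewrite ?id_lfunE //.
  rewrite comp_lfun1l comp_lfun1r => -[g Gg ->].
  by exists (model_point (phi g)); first exact: (model_point_cunit (phi_group hphi Gg)).
rewrite comp_lfun1l comp_lfun1r => -[v vu ->].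
by have [g Gg vE] := model_point_surj vu; exists g; rewrite // vE.
Qed.

End ModelModule.
End UnitGroups.

(** * Classification *)

Section Classification.
Variables (K : closedFieldType) (N : nat) (G : 'M[K]_N -> Prop) (r s : nat).
Variables (phi : 'M[K]_N -> 'M[K]_(r + (1 + s))) (psi : 'M[K]_(r + (1 + s)) -> 'M[K]_N).
Hypothesis hK : [pchar K] =i pred0.
Hypothesis hG : lin_alg_group G.
Hypothesis hcomm : mx_commutative G.
Hypothesis hphi : group_morphism G (@torus_vector_group K r s) phi.
Hypothesis hpsi : group_morphism (@torus_vector_group K r s) G psi.
Hypothesis phiK : forall g, G g -> psi (phi g) = g.
Hypothesis psiK : forall B, torus_vector_group B -> phi (psi B) = B.
Hypothesis hr : (0 < r)%N.
Variable n : nat.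
Hypothesis hdim : has_dimension G n.

Lemma prehom_dim_le (V : prehom_module G) : (\dim {:V} <= n)%N.
Proof. by case: hdim => _; apply; apply: orbit_independent. Qed.

(** The lower bound needs just one module of dimension [r + s]; a constant [c] provides it, using
    [0 < r]. *)
Lemma group_dimension : n = (r + s)%N.
Proof.
apply/eqP; rewrite eqn_leq; apply/andP; split.
  by have [[f [fr fi]] _] := hdim; apply: (dimension_le hG hphi hpsi phiK fr fi).
have [V dV _] := model_module hG hphi hpsi phiK psiK (fun _ : 'I_s => Ordinal hr).
by rewrite -dV; apply: prehom_dim_le.
Qed.

Lemma group_nontrivial : exists2 g, G g & g <> 1%:M.
Proof.
have T : torus_vector_group (tvmx (const_mx (-1) : 'rV[K]_r) (0 : 'rV[K]_s)).
  by apply: tvmx_group => i; rewrite mxE oppr_eq0 oner_neq0.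
exists (psi (tvmx (const_mx (-1)) 0)); first exact: (psi_group hpsi T).
move=> E; have := psiK T; rewrite E (phi1 hG hpsi psiK) -tvmx1.
move/(congr1 (fun B => torus_part B 0 (Ordinal hr))); rewrite !torus_part_tvmx !mxE.
move/eqP; rewrite -subr_eq0 opprK; have /pcharf0P h := hK.
by rewrite -[1 + 1]/(2%:R) h.
Qed.

(** Involutions identify the number of idempotents with [r]. Two inequalities identify [s'] with
    [s]: the vector part embeds, and the dimension of [V] is at most [n]. *)
Lemma algebra_of_normalized (A : falgType K) (V : prehom_module G) :
  alg_commutative A -> normalized_by_diagonal (image_group V) ->
  equivalent (image_group V) (@unit_group K A) ->
  [/\ has_local_summands A r, nilpotent_square_zero A &
      exists c : 'I_s -> 'I_r, model_iso A c].
Proof.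
move=> hc nV VA.
have nA : nilpotent_square_zero A.
  by apply: normalized_nilpotent_square_zero => //; apply: equivalent_normalized nV.
have [U hU] := equivalent_unit_param VA.
have [k [e he]] := primitive_decomposition hc.
have kr : k = r.
  apply: (@involutions_indexed_uniq K A) (prim_decomp_involutions hK hc he) _.
  exact: (up_involutions hK hG hphi hpsi phiK psiK hU).
subst k; split=> //; first exact: prim_decomp_local_summands he.
have [s' [c mA]] := model_structure hK hc he nA.
have ss' := up_vector_dim hK hG hpsi psiK hU mA.
have : (r + s' <= r + s)%N.
  by rewrite -(model_iso_dim mA) -group_dimension -(equivalent_dim VA) prehom_dim_le.
rewrite leq_add2l => s's; have E : s' = s by apply/eqP; rewrite eqn_leq s's.
by subst s'; exists c.
Qed.

Lemma algebra_model (A : falgType K) :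
  alg_commutative A -> \dim {:A} = n -> has_local_summands A r ->
  nilpotent_square_zero A -> exists c : 'I_s -> 'I_r, model_iso A c.
Proof.
move=> hc dA lA nA; have [k [e he]] := primitive_decomposition hc.
have kr : k = r.
  apply: (@involutions_indexed_uniq K A) (prim_decomp_involutions hK hc he) _.
  exact: local_summands_involutions.
subst k; have [s' [c mA]] := model_structure hK hc he nA.
have /eqP := model_iso_dim mA; rewrite dA group_dimension eqn_add2l => /eqP E.
by subst s'; exists c.
Qed.

End Classification.

Theorem corollary3 (K : closedFieldType) (hK : [pchar K] =i pred0)
    (N : nat) (G : 'M[K]_N -> Prop) (n r : nat)
    (hG : lin_alg_group G) (hconn : zariski_connected G)
    (hcomm : mx_commutative G)
    (hn : (1 <= n)%N) (hdim : has_dimension G n)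
    (hr : (1 <= r)%N) (hrank : has_rank G r) :
  (exists M : 'I_(num_partitions r n) -> prehom_module G,
     [/\ forall i, normalized_by_diagonal (image_group (M i)),
         forall i j,
           equivalent (image_group (M i)) (image_group (M j)) ->
           i = j
       & forall V : prehom_module G,
           normalized_by_diagonal (image_group V) ->
           exists i,
             equivalent (image_group V) (image_group (M i))])
  /\
  (forall A : falgType K, alg_commutative A ->
     ((exists V : prehom_module G,
         normalized_by_diagonal (image_group V) /\
         equivalent (image_group V) (unit_group A))
      <->
      [/\ \dim {:A} = n, has_local_summands A r & nilpotent_square_zero A])).
Proof.
have [s [phi [psi [hphi hpsi phiK psiK]]]] := hrank.
have nE : n = (r + s)%N := group_dimension hK hG hphi hpsi phiK psiK hr hdim.
have normal (V : prehom_module G) (c : 'I_s -> 'I_r) :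
    equivalent (image_group V) (model_group (K := K) c) ->
    normalized_by_diagonal (image_group V).
  by move/equivalent_sym/equivalent_normalized; apply; apply: model_normalized.
have classify (V : prehom_module G) (A : falgType K) := 
  @algebra_of_normalized K N G r s phi psi hK hG hphi hpsi phiK psiK hr n hdim A V.
split; last first.
  move=> A hc; split=> [[V [nV VA]]|[dA lA nA]].
    have [lA nA [c mA]] := classify V A hc nV VA.
    by split=> //; rewrite (model_iso_dim mA).
  have [c mA] := algebra_model hK hG hphi hpsi phiK psiK hr hdim hc dA lA nA.
  have [V _ Vc] := model_module hG hphi hpsi phiK psiK c.
  exists V; split; first exact: normal Vc.
  by apply: equivalent_trans Vc _; apply: model_iso_equivalent.
subst n.
(* A part exceeds the fibre size by one: the idempotent itself contributes a dimension to its local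
   summand. *)
have /fin_all_exists[M MP] (i : 'I_(num_partitions r (r + s))) :
    exists V : prehom_module G, exists2 c : 'I_s -> 'I_r,
      forall l, (fiber_size c l).+1 = tnth (enum_val i) l &
      equivalent (image_group V) (model_group (K := K) c).
  have [c cE] := partition_fibers (enum_valP i).
  have [V _ Vc] := model_module hG hphi hpsi phiK psiK c.
  by exists V, c.
exists M; split=> [i|i j ij|V nV].
- by have [c _ Vc] := MP i; apply: normal Vc.
- have [c cE Mc] := MP i; have [c' c'E Mc'] := MP j.
  have [|p pE] := @model_equivalent_fib K hK r s c c'.
    by apply: equivalent_trans (equivalent_sym Mc) (equivalent_trans ij Mc').
  apply: enum_val_inj; apply: (partition_inj (p := p)); try exact: enum_valP.
  by move=> l; rewrite -cE -c'E pE.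
(* Completeness of the list: [V] is equivalent to the units of [A], these to a model, and sorting
   the fibre sizes of the model reaches a listed partition. *)
have [A hc VA] := prehom_algebra hG hcomm V (group_nontrivial hK hG hpsi psiK hr).
have [_ _ [c mA]] := classify V A hc nV VA.
have [t tP [p pE]] := fibers_partition c.
exists (enum_rank_in tP t).
have [c' c'E Mc'] := MP (enum_rank_in tP t).
apply: equivalent_trans VA _; apply: equivalent_trans (equivalent_sym Mc').
apply: equivalent_trans (equivalent_sym (model_iso_equivalent hc mA)) _.
apply: fib_equiv_model; exists p => i; apply: succn_inj.
by rewrite pE c'E enum_rankK_in.
Qed.
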